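(* Fix $0<\beta<\alpha<1$. There is a sequence $(\mathcal{A}_N)_{N\ge1}$ of algorithms, where $\mathcal{A}_N$ is an $N$-sample algorithm (depending only on $N,\alpha,\beta$, and not on $\eta$ or the reservoir), such that for every $\eta\in(0,1)$ and every sequence $(\mu_N)_{N\ge1}$ of reservoir distributions with $G_{\mu_N}^{-1}(1-\eta)\ge\alpha$ for all $N$, letting $a_{i^*}$ denote the output of $\mathcal{A}_N$ run on reservoir $\mu_N$, \[ \limsup_{N\to\infty}\frac{\big(-\log\mathbb{P}[p_{i^*}<\beta]\big)\cdot\log^2 N}{N}\ \ge\ c_{\alpha,\beta}, \qquad c_{\alpha,\beta}=\frac{\big(\arccos(1-2\alpha)-\arccos(1-2\beta)\big)^2}{2}=\frac12\Big(\int_\beta^\alpha\frac{dx}{\sqrt{x(1-x)}}\Big)^2 . \]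
   Context: Infinite-armed Bernoulli bandit: a reservoir distribution $\mu$ is any Borel probability measure on $[0,1]$. There are countably many arms $a_1,a_2,\dots$ whose means $p_1,p_2,\dots$ are drawn i.i.d. from $\mu$ (unknown to the algorithm). Each time arm $a_i$ is sampled it returns a reward in $\{0,1\}$ distributed as Bernoulli$(p_i)$, independently of all other rewards given the means. An algorithm, at each step, chooses (based on previously observed rewards and possibly internal randomness) an arm to sample, and at the end outputs an arm index $i^*$. An $N$-sample algorithm is one that takes exactly $N$ samples almost surely and then outputs $i^*$. Probabilities are over the means, rewards and algorithm randomness. $G_\mu(\tau)=\mu([0,\tau])$ and $G_\mu^{-1}(p)=\inf\{\tau:G_\mu(\tau)\ge p\}$. *)

(* Defs.v *)
From HB Require Import structures.
From mathcomp Require Import all_boot all_order all_algebra.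
From mathcomp Require Import all_classical all_reals all_analysis.
Set Implicit Arguments. Unset Strict Implicit. Unset Printing Implicit Defensive.
Import Order.TTheory GRing.Theory Num.Theory.
Import numFieldNormedType.Exports.
Local Open Scope classical_set_scope.
Local Open Scope ring_scope.

(* A history: the list of (arm index, observed reward) pairs, in order. *)
Definition history := seq (nat * bool).

(* A (possibly randomized) bandit algorithm, given as a behavioural strategy:
   after history h, it samples arm j with probability [choose h j]; once the
   sampling budget is exhausted, it outputs arm index i with probability
   [output h i].  Since histories range over a countable set, this covers all
   algorithms using internal randomness. *)
Record algo (R : realType) := Algo {
  choose : history -> nat -> R;
  output : history -> nat -> R;
  choose_ge0 : forall h j, 0 <= choose h j;
  choose_sum1 : forall h, (\sum_(j <oo) (choose h j)%:E = 1)%E;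
  output_ge0 : forall h i, 0 <= output h i;
  output_sum1 : forall h, (\sum_(i <oo) (output h i)%:E = 1)%E }.

Definition reservoir (R : realType) (mu : probability R R) : Prop :=
  mu [set x : R | 0 <= x <= 1] = 1%E.

(* Revealed means: the means of the arms sampled so far (None = not yet
   revealed; such an arm's mean is a fresh independent draw from mu). *)
Definition upd (R : realType) (m : nat -> option R) (j : nat) (q : R) :=
  fun k => if k == j then Some q else m k.

Definition low_prob (R : realType) (mu : probability R R) (beta : R)
  (o : option R) : \bar R :=
  match o with
  | Some p => if p < beta then 1%E else 0%E
  | None => mu [set x : R | x < beta]
  end.

(* [run A mu beta n h m] = probability that, from history h with revealed
   means m and n samples still to be taken, the algorithm A finally outputs
   an arm of mean < beta (probability over unrevealed means i.i.d. mu,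
   Bernoulli rewards and the algorithm's randomness). *)
Fixpoint run (R : realType) (A : algo R) (mu : probability R R) (beta : R)
  (n : nat) (h : history) (m : nat -> option R) {struct n} : \bar R :=
  match n with
  | 0 => (\sum_(i <oo) ((output A h i)%:E * low_prob mu beta (m i)))%E
  | n'.+1 =>
    (\sum_(j <oo) ((choose A h j)%:E *
       match m j with
       | Some p => p%:E * run A mu beta n' (rcons h (j, true)) m
                   + (1 - p)%:E * run A mu beta n' (rcons h (j, false)) m
       | None => \int[mu]_q
                   (q%:E * run A mu beta n' (rcons h (j, true)) (upd m j q)
                    + (1 - q)%:E * run A mu beta n' (rcons h (j, false)) (upd m j q))
       end))%E
  end.

Definition prob_low (R : realType) (A : algo R) (mu : probability R R)
  (beta : R) (N : nat) : \bar R := run A mu beta N [::] (fun _ => None).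

Definition G (R : realType) (mu : probability R R) (tau : R) : \bar R :=
  mu [set x : R | 0 <= x <= tau].
Definition Ginv (R : realType) (mu : probability R R) (p : R) : R :=
  inf [set tau : R | (p%:E <= G mu tau)%E].

Definition neglog (R : realType) (P : \bar R) : \bar R :=
  if P == 0%E then +oo%E else (- ln (fine P))%:E.

Definition c_const (R : realType) (alpha beta : R) : R :=
  (acos (1 - 2 * alpha) - acos (1 - 2 * beta)) ^+ 2 / 2.

(* Main.v *)
(** Call theta(x) = arccos(1 - 2x), so that theta'(x) = 1/sqrt(x(1-x)) and
    D = theta(alpha) - theta(beta).  After screening groups of fresh arms for one
    arm per group whose empirical mean is close to alpha, run successive rejects:
    with i arms left, sample each up to time about A/i, then drop the worst.
    Rejecting the worst arm only raises the average of theta(empirical mean) over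
    the surviving arms, so for a failure this average has to drop by D through
    sampling alone.  Replace the unknown mean of each surviving arm by a uniform
    one: this costs a factor T+1 per arm sampled T times and turns the smoothed
    empirical means into martingales.  Since theta'^2 x(1-x) <= 1, sample number t
    of an arm among i survivors adds variance at most 1/(i t)^2 to the average.
    With A ~ N/log N the total variance is about log^2 N/N, whence a failure
    probability exp(-D^2 N/(2 log^2 N)).  The upper limit only needs the lengths
    N = kN k. *)
Require Import Defs.
From HB Require Import structures.
From mathcomp Require Import all_boot all_order all_algebra.
From mathcomp Require Import all_classical all_reals all_analysis.
From mathcomp Require Import measurable_realfun ring lra.
Import Order.TTheory GRing.Theory Num.Theory.
Import numFieldNormedType.Exports.
Local Open Scope classical_set_scope.
Local Open Scope ring_scope.

(** The proof is one backward induction on the decision tree, without a union bound over arms or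
    times. The failure probability at a node is bounded by a constant times the product, over the
    arms in play, of U(s, t) / lik p s t. Such a quotient is a supermartingale under the true mean p
    once U(s+1, t+1) + U(s, t+1) <= U(s, t), a condition free of p: U can be designed for the
    uniform mixture, and the unknown means need no control. With i arms left U has slope kappa = lam
    / i, so that the product sees lam times the average of F. The exponent totals about -lam D + b
    lam^2 L / A with L = log N and b close to 1/2, whence lam = D A / L. One log N is the harmonic
    sum in the budget N ~ A L, the other is the same sum in the variance L / A. Screening is
    indispensable because the reservoir may have any mass less than 1 - eta below beta. *)

(** * Integrals over a reservoir *)

Section Measure.
Context {R : realType}.
Import HBNNSimple.
Implicit Types (mu : probability R R) (f h : R -> \bar R).

Lemma measurable_unit_interval : measurable [set x : R | 0 <= x <= 1].
Proof. by rewrite -set_itvcc; exact: measurable_itv. Qed.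

Lemma reservoir_ae mu : reservoir mu -> {ae mu, forall x : R, 0 <= x <= 1}.
Proof.
move=> rmu; exists (~` [set x : R | 0 <= x <= 1]); split => //=.
- by apply: measurableC; exact: measurable_unit_interval.
- rewrite probability_setC; last exact: measurable_unit_interval.
  by rewrite rmu subee.
Qed.

(* No measurability of the left-hand integrand is needed: the integral of a
   nonnegative function is a supremum over the simple functions below it. *)
Lemma ge0_le_integral_reservoir {mu} {f} h : reservoir mu ->
  (forall x, (0 <= f x)%E) -> (forall x, (0 <= h x)%E) ->
  measurable_fun [set: R] h ->
  (forall x, 0 <= x <= 1 -> (f x <= h x)%E) ->
  (\int[mu]_x f x <= \int[mu]_x h x)%E.
Proof.
move=> rmu f0 h0 mh fh; rewrite (ge0_integralTE _ f0).
apply: ge_ereal_sup => _ [s /= sf <-].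
have := integral_nnsfun mu measurableT s; rewrite patch_setT => <-.
apply: ae_ge0_le_integral => //.
- by move=> x _; rewrite lee_fin; exact: fun_ge0.
- exact/measurable_EFinP.
- move: (reservoir_ae mu rmu); apply: filterS => x x01 _.
  exact: le_trans (sf x) (fh _ x01).
Qed.

Lemma integral_ge0_reservoir {mu} {f} : reservoir mu ->
  (forall x, 0 <= x <= 1 -> (0 <= f x)%E) -> (0 <= \int[mu]_x f x)%E.
Proof.
move=> rmu f0; rewrite integralE.
have -> : (\int[mu]_x f^\- x = 0)%E.
  apply/eqP; rewrite eq_le; apply/andP; split; last exact: integral_ge0.
  rewrite -[leRHS](integral0 mu setT).
  apply: ge0_le_integral_reservoir => // x /f0 fx.
  by rewrite funenegE ge_max lexx andbT leeNl oppe0.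
by rewrite sube0; exact: integral_ge0.
Qed.

Lemma integral_le_two_values {mu} {f} (alpha eta a b : R) : reservoir mu ->
  (mu [set x | (x < alpha)%R] <= (1 - eta)%:E)%E -> 0 <= b <= a ->
  (forall x, 0 <= x <= 1 -> (f x <= a%:E)%E) ->
  (forall x, 0 <= x <= 1 -> alpha <= x -> (f x <= b%:E)%E) ->
  (\int[mu]_x f x <= ((1 - eta) * a + eta * b)%:E)%E.
Proof.
move=> rmu mua /andP[b0 ab] fa fb.
have mA : measurable [set x : R | x < alpha].
  by rewrite -set_itvNyo; exact: measurable_itv.
have ab0 : 0 <= a - b by rewrite subr_ge0.
pose h x : \bar R := (cst b%:E x + ((a - b) * \1_[set x : R | x < alpha] x)%:E)%E.
have m2 : measurable_fun [set: R]
    (fun x => ((a - b) * \1_[set x : R | x < alpha] x)%:E).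
  by apply/measurable_EFinP; apply: measurable_funM => //; exact: measurable_indic.
have mh : measurable_fun [set: R] h by apply: emeasurable_funD.
have h0 x : (0 <= h x)%E.
  by rewrite /h adde_ge0 ?lee_fin// mulr_ge0.
apply: (@le_trans _ _ (\int[mu]_x h x)%E).
  rewrite integralE; apply: (@le_trans _ _ (\int[mu]_x f^\+ x)%E).
    by rewrite -[leRHS]sube0; apply: leeB => //; exact: integral_ge0.
  apply: ge0_le_integral_reservoir => // x x01.
  rewrite funeposE ge_max h0 andbT /h /= indicE.
  case: (ltP x alpha) => xa.
    rewrite mem_set//= mulr1 -EFinD [b + _]addrC subrK; exact: fa.
  rewrite memNset//=; last by rewrite /= ltNge xa.
  by rewrite mulr0 adde0; exact: fb.
rewrite /h ge0_integralD//=; last by move=> x _; rewrite lee_fin mulr_ge0.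
rewrite (@integral_cst _ _ _ mu _ measurableT b%:E).
rewrite (@integralZl_indic _ _ _ _ _ _ (fun=> [set x : R | x < alpha]))//; last first.
  by move=> /lt_geF; rewrite ab0.
rewrite integral_indic// setIT.
apply: (@le_trans _ _ (b%:E + (a - b)%:E * (1 - eta)%:E)%E).
  apply: leeD; last by rewrite lee_wpmul2l.
  by rewrite -[leRHS]mule1 lee_wpmul2l// probability_le1.
by rewrite -EFinM -EFinD lee_fin; lra.
Qed.

(** Every t < alpha has G(t) <= 1 - eta, as otherwise the infimum defining [Ginv] would be at most
    t; continuity from below along alpha - 1/(n+1) then gives the mass of [0, alpha). *)
Lemma Ginv_le_mass mu (alpha eta : R) : reservoir mu -> 0 < eta < 1 ->
  alpha <= Ginv mu (1 - eta) -> (mu [set x | (x < alpha)%R] <= (1 - eta)%:E)%E.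
Proof.
move=> rmu /andP[eta0 eta1] aG.
have Glt (t : R) : t < alpha -> (G mu t <= (1 - eta)%:E)%E.
  move=> ta; rewrite leNgt; apply/negP => Gt.
  have : Ginv mu (1 - eta) <= t.
    apply: ge_inf; last by rewrite /= ltW.
    exists 0 => s /=; apply: contraTT; rewrite -!ltNge => s0.
    rewrite /G (_ : [set x : R | _] = set0) ?measure0 ?lte_fin ?subr_gt0//.
    apply/seteqP; split => x //= /andP[x0 xs].
    by move: (le_lt_trans xs s0); rewrite ltNge x0.
  by move=> /(le_trans aG); rewrite leNgt ta.
pose D : set R := [set x : R | 0 <= x < alpha].
pose E n : set R := [set x : R | 0 <= x <= alpha - n.+1%:R^-1].
have mE n : measurable (E n) by rewrite /E -set_itvcc; exact: measurable_itv.
have mD : measurable D by rewrite /D -set_itvco; exact: measurable_itv.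
have UE : \bigcup_n E n = D.
  apply/seteqP; split => x.
    move=> [n _ /= /andP[x0 xn]]; apply/andP; split => //.
    by apply: le_lt_trans xn _; rewrite ltrBlDr ltrDl invr_gt0.
  move=> /= /andP[x0 xa]; have [n ne] := ltr_add_invr xa.
  by exists n => //; rewrite /E /= x0 lerBrDr ltW.
have DE : (mu D <= (1 - eta)%:E)%E.
  have cE : (mu \o E) x @[x --> \oo] --> mu (\bigcup_n E n).
    apply: nondecreasing_cvg_mu => //; first by rewrite UE.
    move=> n m nm; apply/subsetPset => x /= /andP[x0 xn]; rewrite /E /= x0 /=.
    by rewrite (le_trans xn)// lerD2l lerN2 lef_pV2 ?posrE// ler_nat.
  rewrite -UE -(cvg_lim _ cE)//; apply: lime_le.
    by apply/cvg_ex; eexists; exact: cE.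
  by apply: nearW => n; apply: Glt; rewrite ltrBlDr ltrDl invr_gt0.
have mN : measurable [set x : R | x < 0].
  by rewrite -set_itvNyo; exact: measurable_itv.
have N0 : mu [set x : R | x < 0] = 0.
  apply/eqP; rewrite eq_le measure_ge0 andbT.
  have <- : mu (~` [set x : R | 0 <= x <= 1]) = 0%E.
    rewrite probability_setC; last exact: measurable_unit_interval.
    by rewrite rmu subee.
  apply: le_measure; rewrite ?inE//.
    by apply: measurableC; exact: measurable_unit_interval.
  by move=> x /= x0; rewrite leNgt x0.
apply: le_trans DE; rewrite -[leRHS]adde0 -N0.
have mA : measurable [set x : R | x < alpha].
  by rewrite -set_itvNyo; exact: measurable_itv.
apply: (@le_trans _ _ (mu (D `|` [set x : R | x < 0]))).
  apply: le_measure; rewrite ?inE//; first exact: measurableU.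
  by move=> x /= xa; case: (leP 0 x) => x0; [left; rewrite /D/= x0|right].
exact: measureU2.
Qed.

End Measure.

(** * Algorithms as decision trees *)

Inductive prog := Ret of nat | Smp of nat & (bool -> prog).

Fixpoint depth_le (p : prog) (n : nat) : Prop :=
  match p with
  | Ret _ => True
  | Smp _ k => match n with
               | 0 => False
               | n'.+1 => forall b, depth_le (k b) n'
               end
  end.

Definition prog_arm (p : prog) : nat :=
  match p with Ret i => i | Smp j _ => j end.

Definition prog_step (p : prog) (b : bool) : prog :=
  match p with Ret i => Ret i | Smp _ k => k b end.

Definition prog_after (p : prog) (h : history) : prog :=
  foldl (fun p jb => prog_step p jb.2) p h.

Section Programs.
Context {R : realType}.

Lemma nneseries_delta (a : nat) (f : nat -> \bar R) :
  (\sum_(j <oo) ((j == a)%:R%:E * f j) = f a)%E.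
Proof.
apply: lim_near_cst => //; near=> n.
have an : (a < n)%N by near: n; exists a.+1.
rewrite (bigD1_seq a) ?mem_index_iota ?iota_uniq//= eqxx mul1e.
by rewrite big1 ?adde0// => i /negPf ->; rewrite mul0e.
Unshelve. all: by end_near. Qed.

Lemma nneseries_delta1 (a : nat) : (\sum_(j <oo) ((j == a)%:R : R)%:E = 1)%E.
Proof.
rewrite -[RHS](nneseries_delta a (fun=> 1%E)).
by apply: eq_eseriesr => j _; rewrite mule1.
Qed.

Lemma delta_ge0 (a j : nat) : 0 <= (j == a)%:R :> R.
Proof. exact: ler0n. Qed.

(* Once the program has returned an arm, the remaining budget is spent on it. *)
Definition algo_of (p : prog) : algo R :=
  @Algo R (fun h j => (j == prog_arm (prog_after p h))%:R)
          (fun h j => (j == prog_arm (prog_after p h))%:R)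
          (fun h => delta_ge0 _) (fun h => nneseries_delta1 _)
          (fun h => delta_ge0 _) (fun h => nneseries_delta1 _).

Variables (mu : probability R R) (beta : R).

Fixpoint prog_low (p : prog) (m : nat -> option R) : \bar R :=
  match p with
  | Ret i => low_prob mu beta (m i)
  | Smp j k => match m j with
    | Some x => (x%:E * prog_low (k true) m + (1 - x)%:E * prog_low (k false) m)%E
    | None => (\int[mu]_q (q%:E * prog_low (k true) (upd m j q)
                 + (1 - q)%:E * prog_low (k false) (upd m j q)))%E
    end
  end.

Lemma convex_comb_same (x : R) (y : \bar R) : y \is a fin_num ->
  (x%:E * y + (1 - x)%:E * y = y)%E.
Proof. by move=> /fineK <-; rewrite -!EFinM -EFinD -mulrDl subrKC mul1r. Qed.

Lemma low_prob_fin_num o : low_prob mu beta o \is a fin_num.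
Proof.
case: o => [x|] /=; first by case: ifP.
by apply: fin_num_measure; rewrite -set_itvNyo; exact: measurable_itv.
Qed.

(** Samples spent after a leaf change nothing. If the returned arm was never sampled before, its
    mean is revealed by them and integrates back to the mass below [beta], the value of [low_prob]
    at [None]. *)
Lemma run_prog p n h m : depth_le (prog_after p h) n ->
  run (algo_of p) mu beta n h m = prog_low (prog_after p h) m.
Proof.
have after_rcons h' jb :
    prog_after p (rcons h' jb) = prog_step (prog_after p h') jb.2.
  by rewrite /prog_after foldl_rcons.
elim: n h m => [|n IH] h m.
  case E : (prog_after p h) => [i|j k] //= _.
  by rewrite E nneseries_delta.
case E : (prog_after p h) => [i|j k] dle; rewrite [LHS]/= E nneseries_delta /=.
- have IHr b m' : run (algo_of p) mu beta n (rcons h (i, b)) m'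
      = low_prob mu beta (m' i).
    by rewrite IH after_rcons E.
  rewrite !IHr; case mi : (m i) => [x|].
    by rewrite convex_comb_same ?low_prob_fin_num.
  under eq_integral do rewrite !IHr convex_comb_same ?low_prob_fin_num//.
  transitivity (\int[mu]_q (\1_[set x : R | (x < beta)%R] q)%:E)%E.
    apply: eq_integral => q _; rewrite /upd eqxx /= indicE.
    by case: ifPn => qb; [rewrite mem_set|rewrite memNset//=; exact/negP].
  rewrite integral_indic ?setIT//.
  by rewrite -set_itvNyo; exact: measurable_itv.
- have IHr b m' : run (algo_of p) mu beta n (rcons h (j, b)) m'
      = prog_low (k b) m'.
    by rewrite IH after_rcons E.
  case: (m j) => [x|]; first by rewrite !IHr.
  by apply: eq_integral => q _; rewrite !IHr.
Qed.

(** A child is bounded only if its reward has positive probability: the bounds to come divide by the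
    likelihood, which vanishes on impossible histories. *)
Lemma prog_low_Smp_le p j k m (x y : R) : m j = Some p -> 0 <= p <= 1 ->
  (0 < p -> (prog_low (k true) m <= x%:E)%E) ->
  (p < 1 -> (prog_low (k false) m <= y%:E)%E) ->
  (prog_low (Smp j k) m <= (p * x + (1 - p) * y)%:E)%E.
Proof.
move=> /= -> /andP[p0 p1] hx hy; rewrite [leRHS]EFinD; apply: leeD.
- have [->|pn0] := eqVneq p 0; first by rewrite mul0e mul0r.
  by rewrite EFinM lee_wpmul2l// hx// lt_def pn0.
- have [->|pn1] := eqVneq p 1; first by rewrite subrr mul0e mul0r.
  by rewrite EFinM lee_wpmul2l ?lee_fin ?subr_ge0// hy// lt_def eq_sym pn1.
Qed.

Lemma prog_low_ge0 p m : reservoir mu ->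
  (forall j x, m j = Some x -> 0 <= x <= 1) -> (0 <= prog_low p m)%E.
Proof.
move=> rmu; elim: p m => [i|j k IH] m m01 /=.
  by case: (m i) => [x|]; rewrite /= ?measure_ge0//; case: ifP.
case mj : (m j) => [x|].
  have /andP[x0 x1] := m01 _ _ mj.
  by rewrite adde_ge0// mule_ge0 ?lee_fin ?subr_ge0// IH.
apply: integral_ge0_reservoir => // q q01; have /andP[q0 q1] := q01.
have u01 i x : upd m j q i = Some x -> 0 <= x <= 1.
  by rewrite /upd; case: ifP => [_ [<-]|_ /m01].
by rewrite adde_ge0// mule_ge0 ?lee_fin ?subr_ge0// IH.
Qed.

End Programs.

(** * Likelihoods and the uniform mixture *)

Section Mixture.
Context {R : realType}.
Implicit Types p u : R.

Definition lik p (s t : nat) : R := p ^+ s * (1 - p) ^+ (t - s).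

(* The uniform mixture over p of [lik p s t], that is the Beta function
   B(s + 1, t - s + 1): the Laplace rule of succession. *)
Definition mix (s t : nat) : R := (s`! * (t - s)`!)%:R / (t.+1)`!%:R.

Lemma fact_neq0 n : n`!%:R != 0 :> R.
Proof. by rewrite pnatr_eq0 -lt0n fact_gt0. Qed.

Lemma mix_gt0 s t : 0 < mix s t.
Proof. by rewrite divr_gt0 ?ltr0n ?muln_gt0 ?fact_gt0. Qed.

Lemma mix_succ s t : (s <= t)%N ->
  mix s.+1 t.+1 = mix s t * (s.+1%:R / t.+2%:R).
Proof.
move=> st; rewrite /mix subSS factS [(t.+2)`!]factS -mulnA natrM [X in _ / X]natrM.
by rewrite invfM mulrACA mulrC.
Qed.

Lemma mix_fail s t : (s <= t)%N ->
  mix s t.+1 = mix s t * (1 - s.+1%:R / t.+2%:R).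
Proof.
move=> st; rewrite /mix subSn// factS [(t.+2)`!]factS mulnCA natrM [X in _ / X]natrM.
rewrite invfM mulrACA mulrC; congr (_ * _).
have -> : (t - s).+1%:R = t.+2%:R - s.+1%:R :> R.
  by rewrite -natrB ?subSS ?subSn// ltnS ltnW.
by rewrite mulrBl divff// pnatr_eq0.
Qed.

(** Under the uniform mixture the t+1 success counts are equally likely; the factor t+1 paid per arm
    originates here. *)
Lemma bin_mix s t : (s <= t)%N -> 'C(t, s)%:R * (t.+1%:R * mix s t) = 1.
Proof.
move=> st; rewrite /mix mulrA -natrM mulrA -natrM [('C(t, s) * _)%N]mulnC.
by rewrite -mulnA bin_fact// -factS divff ?fact_neq0.
Qed.

Lemma lik_succ p s t : lik p s.+1 t.+1 = p * lik p s t.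
Proof. by rewrite /lik subSS exprS mulrA. Qed.

Lemma lik_fail p s t : (s <= t)%N -> lik p s t.+1 = (1 - p) * lik p s t.
Proof. by move=> st; rewrite /lik subSn// exprS mulrCA. Qed.

(** Keep only the term with s successes in the binomial expansion of (1 - p + p e^u)^t, then trade
    the binomial coefficient for the mixture by [bin_mix]. *)
Lemma lik_chernoff p u s t : 0 <= p <= 1 -> (s <= t)%N ->
  lik p s t <= t.+1%:R * mix s t * (expR (- (u * s%:R)) * (1 - p + p * expR u) ^+ t).
Proof.
move=> /andP[p0 p1] st; have C0 : 0 < 'C(t, s)%:R :> R by rewrite ltr0n bin_gt0.
rewrite -(ler_pM2l C0) [leRHS]mulrA bin_mix// mul1r.
rewrite expRN ler_pdivlMl ?expR_gt0// exprDn.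
rewrite (bigD1 (Ordinal (st : (s < t.+1)%N)))//= -[leLHS]addr0; apply: lerD.
  rewrite exprMn expRM_natr /lik -mulr_natr.
  by rewrite le_eqVlt; apply/orP; left; apply/eqP; move: (_ ^+ s) (_ ^+ (t - s)) (_ ^+ s) => x y z; ring.
rewrite sumr_ge0// => i _; rewrite mulrn_wge0// mulr_ge0 ?exprn_ge0 ?subr_ge0//.
by rewrite mulr_ge0 ?expR_ge0.
Qed.

Lemma lik_le_mix p s t : 0 <= p <= 1 -> (s <= t)%N ->
  lik p s t <= t.+1%:R * mix s t.
Proof.
move=> p01 st; have := lik_chernoff p 0 s t p01 st.
by rewrite mul0r oppr0 expR0 mulr1 subrK expr1n !mulr1.
Qed.

(** The factor p cancels against the one in lik p (s+1) (t+1), and 1 - p likewise. At p = 0 or p = 1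
    one term is lost instead, hence the nonnegativity hypotheses. *)
Lemma ratio_superharmonic p (U : nat -> nat -> R) s t : 0 <= p <= 1 ->
  (s <= t)%N -> 0 < lik p s t ->
  0 <= U s.+1 t.+1 -> 0 <= U s t.+1 -> U s.+1 t.+1 + U s t.+1 <= U s t ->
  p * (U s.+1 t.+1 / lik p s.+1 t.+1) + (1 - p) * (U s t.+1 / lik p s t.+1)
    <= U s t / lik p s t.
Proof.
move=> /andP[p0 p1] st l0 U1 U0 hU; rewrite lik_succ lik_fail//.
have h (x y : R) : 0 <= x -> 0 <= y -> x * (y / (x * lik p s t)) <= y / lik p s t.
  move=> x0 y0; have [->|xn0] := eqVneq x 0; first by rewrite mul0r divr_ge0// ltW.
  by rewrite invfM mulrCA (mulrA x) divff// mul1r.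
apply: (@le_trans _ _ (U s.+1 t.+1 / lik p s t + U s t.+1 / lik p s t)).
  by apply: lerD; apply: h => //; rewrite subr_ge0.
by rewrite -mulrDl ler_pM2r ?invr_gt0.
Qed.

End Mixture.

Fixpoint smp (j n s : nat) (k : nat -> prog) : prog :=
  if n is n'.+1 then Smp j (fun b => smp j n' (s + b) k) else k s.

Fixpoint smpl (l : seq (nat * nat)) (n : nat) (acc : seq (nat * nat))
    (k : seq (nat * nat) -> prog) : prog :=
  if l is (j, s) :: l' then smp j n s (fun s' => smpl l' n ((j, s') :: acc) k)
  else k acc.

Section Sampling.
Context {R : realType} (mu : probability R R) (beta : R).
Implicit Types (m : nat -> option R) (U : nat -> nat -> R).
Local Notation prog_low := (prog_low mu beta).

Lemma smp_le p m j n s t k (rho : nat -> nat -> R) :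
  m j = Some p -> 0 <= p <= 1 -> (s <= t)%N -> 0 < lik p s t ->
  (forall s' t', (s' <= t')%N -> (t <= t' < t + n)%N -> 0 < lik p s' t' ->
     p * rho s'.+1 t'.+1 + (1 - p) * rho s' t'.+1 <= rho s' t') ->
  (forall s', (s' <= t + n)%N -> 0 < lik p s' (t + n) ->
     (prog_low (k s') m <= (rho s' (t + n)%N)%:E)%E) ->
  (prog_low (smp j n s k) m <= (rho s t)%:E)%E.
Proof.
move=> mj p01; have /andP[p0 p1] := p01.
elim: n s t => [|n IH] s t st l0 hrho hk.
  by have := hk s; rewrite addn0 => ->.
apply: le_trans (_ : (_ <= (p * rho s.+1 t.+1 + (1 - p) * rho s t.+1)%:E)%E) _;
  last by rewrite lee_fin hrho// leqnn addnS ltnS leq_addr.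
have hrho' s' t' : (s' <= t')%N -> (t.+1 <= t' < t.+1 + n)%N -> 0 < lik p s' t' ->
    p * rho s'.+1 t'.+1 + (1 - p) * rho s' t'.+1 <= rho s' t'.
  by move=> ? /andP[tt' t'n]; apply: hrho => //; rewrite ltnW//= addnS -addSn.
have hk' s' : (s' <= t.+1 + n)%N -> 0 < lik p s' (t.+1 + n) ->
    (prog_low (k s') m <= (rho s' (t.+1 + n)%N)%:E)%E.
  by rewrite addSnnS; exact: hk.
apply: (@prog_low_Smp_le _ _ _ p) => // [pp|pp].
- by rewrite addn1; apply: IH => //; rewrite lik_succ mulr_gt0.
- rewrite addn0; apply: IH => //; first exact: leqW.
  by rewrite lik_fail// mulr_gt0// subr_gt0.
Qed.

Definition valid m (t : nat) (a : nat * nat) : Prop :=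
  exists p, [/\ m a.1 = Some p, 0 <= p <= 1, (a.2 <= t)%N & 0 < lik p a.2 t].

Definition mean m (a : nat * nat) : R := odflt 0 (m a.1).

Definition ratio m U (t : nat) (a : nat * nat) : R :=
  U a.2 t / lik (mean m a) a.2 t.

Lemma valid_mean m t a : valid m t a ->
  [/\ 0 <= mean m a <= 1, (a.2 <= t)%N & 0 < lik (mean m a) a.2 t].
Proof. by move=> [p [ma p01 at_ l0]]; rewrite /mean ma. Qed.

Lemma smpl_le m U l n acc t (c : R) k :
  (forall s t, 0 <= U s t) ->
  (forall s' t', (s' <= t')%N -> (t <= t')%N ->
     U s'.+1 t'.+1 + U s' t'.+1 <= U s' t') ->
  0 <= c ->
  {in l, forall a, valid m t a} -> {in acc, forall a, valid m (t + n) a} ->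
  (forall l', size l' = (size l + size acc)%N ->
     {in l', forall a, valid m (t + n) a} ->
     (prog_low (k l') m <= (c * \prod_(a <- l') ratio m U (t + n) a)%:E)%E) ->
  (prog_low (smpl l n acc k) m <=
     (c * (\prod_(a <- l) ratio m U t a * \prod_(a <- acc) ratio m U (t + n) a))%:E)%E.
Proof.
move=> U0 hU; elim: l acc c => [|[j s] l IH] acc c c0 vl vacc hk /=.
  by rewrite big_nil mul1r; exact: hk.
have [p [/= mj p01 st l0]] := vl (j, s) (mem_head _ _).
have rho0 (t' : nat) a : valid m t' a -> 0 <= ratio m U t' a.
  by move=> /valid_mean[_ _ /ltW ?]; rewrite divr_ge0.
(* The quotients of the arms not being sampled act as a constant factor. *)
pose c' := c * (\prod_(a <- l) ratio m U t a * \prod_(a <- acc) ratio m U (t + n) a).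
have c'0 : 0 <= c'.
  rewrite mulr_ge0// mulr_ge0// big_seq prodr_ge0// => a a_in; apply: rho0.
    by apply: vl; rewrite inE a_in orbT.
  exact: vacc.
have -> : c * (\prod_(a <- (j, s) :: l) ratio m U t a *
    \prod_(a <- acc) ratio m U (t + n) a) = c' * (U s t / lik p s t).
  by rewrite big_cons /ratio /mean /= mj /= /c'; ring.
apply: (smp_le p m j n s t _ (fun s t => c' * (U s t / lik p s t))) => //.
- move=> s' t' s't' /andP[tt' _] l'0; rewrite mulrCA [(1 - p) * _]mulrCA -mulrDr.
  by rewrite ler_wpM2l// ratio_superharmonic// hU.
- move=> s' s't l'0.
  have v' : valid m (t + n) (j, s') by exists p.
  have := IH ((j, s') :: acc) c c0.
  have e : ratio m U (t + n) (j, s') = U s' (t + n)%N / lik p s' (t + n).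
    by rewrite /ratio /mean /= mj.
  rewrite big_cons e.
  set A := (_ * _) => hA; set B := (X in (_ <= X%:E)%E).
  have -> : B = A.
    by rewrite /A /B /c'; ring.
  apply: hA.
  - by move=> a al; apply: vl; rewrite inE al orbT.
  - by move=> a; rewrite inE => /orP[/eqP ->//|]; exact: vacc.
  - by move=> l' sl'; apply: hk; rewrite sl' /= addnS.
Qed.

End Sampling.

(** * The algorithm and its screening phase *)

Definition fewest_successes (a b : nat * nat) : bool := (a.2 <= b.2)%N.

(* Successive rejects on the M.+1 arms of l, each sampled t times so far: with
   i arms left, all of them are sampled up to time tau i, then the worst goes. *)
Fixpoint rejects (tau : nat -> nat) (M : nat) (l : seq (nat * nat)) (t : nat) : prog :=
  if M is M'.+1 then
    smpl l (tau M'.+2 - t) [::]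
      (fun l' => rejects tau M' (behead (sort fewest_successes l')) (tau M'.+2))
  else smpl l (tau 1 - t) [::] (fun l' => Ret (head (0, 0) l').1).

(** The last of the g+1 arms is kept even below the threshold, so that every group delivers an arm
    within a fixed number of samples. *)
Fixpoint try_arms (thr ell j g : nat) (k : nat * nat -> prog) : prog :=
  smp j ell 0 (fun s => if (thr <= s)%N then k (j, s)
    else if g is g'.+1 then try_arms thr ell j.+1 g' k else k (j, s)).

Fixpoint screen (thr ell g M j : nat) (acc : seq (nat * nat))
    (k : seq (nat * nat) -> prog) : prog :=
  if M is M'.+1 then
    try_arms thr ell j g (fun a => screen thr ell g M' a.1.+1 (a :: acc) k)
  else k acc.

Section Depth.

Lemma depth_leW p d d' : (d <= d')%N -> depth_le p d -> depth_le p d'.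
Proof.
elim: p d d' => [i|j k IH] [|d] [|d'] //= dd' h b.
exact: (IH b d d').
Qed.

Lemma smp_depth j n s k d :
  (forall s', depth_le (k s') d) -> depth_le (smp j n s k) (n + d).
Proof. by move=> hk; elim: n s => [|n IH] s //= b; exact: IH. Qed.

Lemma smpl_depth l n acc k d :
  (forall l', size l' = (size l + size acc)%N -> depth_le (k l') d) ->
  depth_le (smpl l n acc k) (size l * n + d).
Proof.
elim: l acc => [|[j s] l IH] acc hk; first exact: hk.
rewrite mulSn -addnA; apply: smp_depth => s'; apply: IH => l' sl'.
by apply: hk; rewrite sl' /= addnS.
Qed.

(** Count by arms: the one dropped with i arms left has been sampled tau i times in all, t of them
    before the start, whence the term (M+1) t. *)
Lemma rejects_depth tau M l t : size l = M.+1 -> (t <= tau M.+1)%N ->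
  (forall i, (tau i.+2 <= tau i.+1)%N) ->
  exists2 d, depth_le (rejects tau M l t) d
    & (d + M.+1 * t <= \sum_(i < M.+1) tau i.+1)%N.
Proof.
move=> + + tau_dec; elim: M l t => [|M IH] l t sl tt.
  exists (1 * (tau 1 - t) + 0)%N.
    have := smpl_depth l (tau 1 - t) [::] (fun l' => Ret (head (0, 0) l').1) 0.
    by rewrite sl; exact.
  by rewrite big_ord_recr big_ord0 /= !mul1n addn0 subnK.
(* A dummy list, since only the length matters; [dle] shows that the truncated subtraction in [d']
   is a true one. *)
have [d hd dle] := IH (nseq M.+1 (0, 0)) (tau M.+2) (size_nseq _ _) (tau_dec M).
pose d' := (\sum_(i < M.+1) tau i.+1 - M.+1 * tau M.+2)%N.
exists (M.+2 * (tau M.+2 - t) + d')%N.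
  have := smpl_depth l (tau M.+2 - t) [::] (fun l' =>
    rejects tau M (behead (sort fewest_successes l')) (tau M.+2)) d'.
  rewrite sl; apply => l' sl'.
  have sb : size (behead (sort fewest_successes l')) = M.+1.
    by rewrite size_behead size_sort sl' addn0.
  have [d2 hd2 d2le] := IH _ (tau M.+2) sb (tau_dec M).
  by apply: depth_leW hd2; rewrite leq_subRL ?(leq_trans _ d2le) ?leq_addl// addnC.
rewrite big_ord_recr /= addnAC -mulnDr subnK// mulSn -addnA addnC leq_add2r.
by rewrite /d' subnKC// (leq_trans _ dle)// leq_addl.
Qed.

Lemma try_arms_depth thr ell j g k d :
  (forall a, depth_le (k a) d) ->
  depth_le (try_arms thr ell j g k) (g.+1 * ell + d).
Proof.
move=> hk; elim: g j => [|g IH] j.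
  by rewrite mul1n; apply: smp_depth => s; case: ifP.
rewrite mulSn -addnA; apply: smp_depth => s; case: ifP => _; last exact: IH.
by apply: depth_leW (hk _); rewrite leq_addl.
Qed.

Lemma screen_depth thr ell g M j acc k d :
  (forall l, size l = (M + size acc)%N -> depth_le (k l) d) ->
  depth_le (screen thr ell g M j acc k) (M * (g.+1 * ell) + d).
Proof.
elim: M j acc => [|M IH] j acc hk; first exact: hk.
rewrite mulSn -addnA; apply: try_arms_depth => a; apply: IH => l sl.
by apply: hk; rewrite sl /= addnS.
Qed.

End Depth.

Section Screening.
Context {R : realType} (mu : probability R R) (beta alpha eta : R).
Local Notation prog_low := (prog_low mu beta).
Hypotheses (rmu : reservoir mu)
  (mass : (mu [set x | (x < alpha)%R] <= (1 - eta)%:E)%E)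
  (eta01 : 0 < eta < 1).
Variables (thr n g : nat) (U : nat -> nat -> R) (e0 e1 v : R).
Local Notation ell := n.+1.
Hypotheses (e10 : 0 <= e1 <= e0) (U0 : forall s t, 0 <= U s t) (v0 : 0 <= v)
  (Ue0 : forall s, (s <= ell)%N -> U s ell <= e0 * mix s ell)
  (Ue1 : forall s, (thr <= s <= ell)%N -> U s ell <= e1 * mix s ell)
  (tail : forall p, alpha <= p <= 1 ->
    expR (v * thr%:R) * (1 - p + p * expR (- v)) ^+ ell <= 2^-1).

(** Bounds the expected quotient delivered by a group. The summand e1 pays for the current arm
    passing. The arm fails with probability at most 1 - eta/2: its mean is at least [alpha] with
    probability at least eta, and then it passes with probability at least 1/2. The last arm is
    taken unconditionally, at the price e0. *)
Fixpoint group_factor (g : nat) : R :=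
  if g is g'.+1 then e1 + (1 - eta / 2) * group_factor g' else e0.

Lemma group_factor_ge0 g' : 0 <= group_factor g'.
Proof.
have := eta01; have := e10.
by elim: g' => [|g' IH] /=; nra.
Qed.

(** Revealing the mean at once or at the first sample is the same provided that a sample follows;
    hence the form n+1 of [ell]. *)
Lemma prog_low_fresh j k m : m j = None ->
  prog_low (smp j ell 0 k) m = (\int[mu]_q prog_low (smp j ell 0 k) (upd m j q))%E.
Proof.
by move=> mj /=; rewrite mj; apply: eq_integral => q _; rewrite {3}/upd eqxx.
Qed.

(* Chernoff majorant, exactly a martingale in (s, t), of the probability of
   ending below the threshold. *)
Let low_tail (p : R) (s t : nat) : R :=
  if alpha <= p
  then expR (v * (thr%:R - s%:R)) * (1 - p + p * expR (- v)) ^+ (ell - t)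
  else 1.

Let low_tail_mart p s t : (t < ell)%N ->
  p * low_tail p s.+1 t.+1 + (1 - p) * low_tail p s t.+1 = low_tail p s t.
Proof.
move=> tl; rewrite /low_tail; case: ifP => _; last by rewrite !mulr1 subrKC.
rewrite -[(ell - t)%N]prednK ?subn_gt0// -subnS exprS.
have -> : v * (thr%:R - s.+1%:R) = - v + v * (thr%:R - s%:R) by rewrite -natr1; ring.
by rewrite expRD; ring.
Qed.

Let low_tail_ge0 p s t : 0 <= p <= 1 -> 0 <= low_tail p s t.
Proof.
move=> /andP[p0 p1]; rewrite /low_tail; case: ifP => // _.
by rewrite mulr_ge0 ?expR_ge0// exprn_ge0// addr_ge0 ?subr_ge0// mulr_ge0 ?expR_ge0.
Qed.

Lemma try_arms_le j m (Y : R) k : 0 <= Y ->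
  (forall i, (j <= i)%N -> m i = None) ->
  (forall m' a, (forall i, (i < j)%N -> m' i = m i) ->
     (forall i, (a.1 < i)%N -> m' i = None) -> valid m' ell a ->
     (prog_low (k a) m' <= (Y * ratio m' U ell a)%:E)%E) ->
  (prog_low (try_arms thr ell j g k) m <= (Y * group_factor g)%:E)%E.
Proof.
move=> Y0; have /andP[eta0 eta1] := eta01; have /andP[e1_0 e10'] := e10.
have e00 : 0 <= e0 by exact: le_trans e10'.
have mix00 p : mix 0 0 / lik p 0 0 = 1 :> R.
  by rewrite /mix /lik !expr0 fact0 mulr1 divr1 divr1.
have rho_super (p e : R) (s' t' : nat) : 0 <= p <= 1 -> 0 <= e -> (s' <= t')%N ->
    0 < lik p s' t' ->
    p * (e * (mix s'.+1 t'.+1 / lik p s'.+1 t'.+1))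
      + (1 - p) * (e * (mix s' t'.+1 / lik p s' t'.+1))
    <= e * (mix s' t' / lik p s' t').
  move=> p01 ee st l0; rewrite mulrCA [(1 - p) * _]mulrCA -mulrDr ler_wpM2l//.
  apply: (ratio_superharmonic _ mix) => //; try exact/ltW/mix_gt0.
  by rewrite mix_succ// mix_fail// -mulrDr subrKC mulr1.
elim: g j m => [|g' IH] j m mN hk.
- rewrite /try_arms prog_low_fresh ?mN//.
  apply: le_trans (_ : (_ <= ((1 - eta) * (Y * e0) + eta * (Y * e0))%:E)%E) _;
    last by rewrite lee_fin /=; lra.
  suff h (q : R) : 0 <= q <= 1 -> (prog_low (smp j ell 0 (fun s =>
        if (thr <= s)%N then k (j, s) else k (j, s))) (upd m j q) <= (Y * e0)%:E)%E.
    apply: (integral_le_two_values alpha) => //; first by rewrite mulr_ge0/=.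
    by move=> x x01 _; exact: h.
  move=> q01; set m' := upd m j q.
  have m'j : m' j = Some q by rewrite /m' /upd eqxx.
  rewrite -[Y * e0]mulr1 -(mix00 q).
  apply: (smp_le _ _ q _ _ _ _ _ _ (fun s t => Y * e0 * (mix s t / lik q s t)))
    => //; first by rewrite /lik !expr0 mulr1.
    by move=> s' t' st _ l0; apply: rho_super => //; rewrite mulr_ge0.
  move=> s sl l0; rewrite add0n in sl l0 *.
  rewrite if_same; apply: le_trans (hk m' (j, s) _ _ _) _.
  + by move=> i ij; rewrite /m' /upd ltn_eqF.
  + by move=> i ij; rewrite /m' /upd gtn_eqF//= mN// ltnW.
  + by exists q.
  + rewrite lee_fin -mulrA ler_wpM2l// /ratio /mean /= m'j /= mulrA.
    by rewrite ler_pM2r ?invr_gt0// Ue0.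
- rewrite /try_arms -/try_arms prog_low_fresh ?mN//.
  have G0 := group_factor_ge0 g'; set G := group_factor g' in G0.
  suff h (q : R) : 0 <= q <= 1 -> (prog_low (smp j ell 0 (fun s =>
        if (thr <= s)%N then k (j, s) else try_arms thr ell j.+1 g' k)) (upd m j q)
        <= (Y * (e1 + G * low_tail q 0 0))%:E)%E.
    have tail2 q : 0 <= q <= 1 -> alpha <= q -> low_tail q 0 0 <= 2^-1.
      by move=> /andP[_ q1] aq; rewrite /low_tail aq subr0 subn0 tail// aq.
    have tail1 q : 0 <= q <= 1 -> low_tail q 0 0 <= 1.
      move=> q01; case: (leP alpha q) => aq.
        by rewrite (le_trans (tail2 _ q01 aq))// invf_le1// ler1n.
      by rewrite /low_tail (lt_geF aq).
    (* Weight of the failing branch: (1 - eta) + eta / 2 = 1 - eta / 2. *)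
    have <- : (1 - eta) * (Y * (e1 + G)) + eta * (Y * (e1 + G / 2))
        = Y * (e1 + (1 - eta / 2) * G) by field.
    apply: (integral_le_two_values alpha) => //.
    + by apply/andP; split; [rewrite mulr_ge0// addr_ge0// divr_ge0|
        rewrite ler_wpM2l// lerD2l; lra].
    + move=> q q01; apply: le_trans (h q q01) _.
      by rewrite lee_fin ler_wpM2l// lerD2l -[leRHS]mulr1 ler_wpM2l// tail1.
    + move=> q q01 aq; apply: le_trans (h q q01) _.
      by rewrite lee_fin ler_wpM2l// lerD2l ler_wpM2l// tail2.
  move=> q01; set m' := upd m j q.
  have m'j : m' j = Some q by rewrite /m' /upd eqxx.
  have m'lt i : (i < j)%N -> m' i = m i by move=> ij; rewrite /m' /upd ltn_eqF.
  have m'gt i : (j < i)%N -> m' i = None.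
    by move=> ij; rewrite /m' /upd gtn_eqF//= mN// ltnW.
  rewrite -[e1]mulr1 -(mix00 q).
  (* A sum of two processes: e1 times the mixture quotient covers passing, G times the Chernoff
     majorant covers failing. *)
  apply: (smp_le _ _ q _ _ _ _ _ _
    (fun s t => Y * (e1 * (mix s t / lik q s t) + G * low_tail q s t)))
    => //; first by rewrite /lik !expr0 mulr1.
    move=> s' t' st /andP[_ tl] l0.
    rewrite mulrCA [(1 - q) * _]mulrCA -mulrDr ler_wpM2l//.
    rewrite -(low_tail_mart q s' t')//.
    by have := rho_super q e1 s' t' q01 e1_0 st l0; lra.
  move=> s sl l0; rewrite add0n in sl l0 *.
  have lt0 := low_tail_ge0 q s ell q01.
  have mr0 : 0 <= mix s ell / lik q s ell by rewrite divr_ge0// ltW// mix_gt0.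
  case: ifPn => ts.
    apply: le_trans (hk m' (j, s) m'lt m'gt _) _; first by exists q.
    rewrite lee_fin ler_wpM2l// /ratio /mean /= m'j /=.
    apply: (@le_trans _ _ (e1 * (mix s ell / lik q s ell))).
      by rewrite mulrA ler_pM2r ?invr_gt0// Ue1// ts.
    by rewrite lerDl mulr_ge0.
  apply: le_trans (IH j.+1 m' _ _) _.
  + by move=> i ij; exact: m'gt.
  + move=> m2 a h1 h2 va; apply: hk => // i ij.
    by rewrite h1 ?m'lt// ltnW.
  + rewrite lee_fin ler_wpM2l//.
    apply: (@le_trans _ _ (G * low_tail q s ell)); last first.
      by rewrite lerDr mulr_ge0.
    rewrite -[leLHS]mulr1 ler_wpM2l// /low_tail; case: ifP => // _.
    rewrite subnn expr0 mulr1 -[leLHS]expR0 ler_expR mulr_ge0// subr_ge0 ler_nat.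
    by rewrite ltnW// ltnNge.
Qed.

Lemma screen_le M j acc m (c : R) k : 0 <= c ->
  (forall i, (j <= i)%N -> m i = None) ->
  {in acc, forall a, valid m ell a} ->
  (forall m' l, size l = (M + size acc)%N -> {in l, forall a, valid m' ell a} ->
     (prog_low (k l) m' <= (c * \prod_(a <- l) ratio m' U ell a)%:E)%E) ->
  (prog_low (screen thr ell g M j acc k) m <=
     (c * group_factor g ^+ M * \prod_(a <- acc) ratio m U ell a)%:E)%E.
Proof.
move=> c0; elim: M j acc m => [|M IH] j acc m mN vacc hk.
  by rewrite expr0 mulr1; exact: hk.
rewrite exprSr mulrA -[X in (_ <= X%:E)%E]mulrA [group_factor g * _]mulrC mulrA.
have prod0 : 0 <= \prod_(a <- acc) ratio m U ell a.
  rewrite big_seq prodr_ge0// => a /vacc/valid_mean[_ _ /ltW ?].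
  by rewrite divr_ge0.
apply: try_arms_le => //.
  by rewrite !mulr_ge0// exprn_ge0// group_factor_ge0.
move=> m' a hlt hgt va.
(* Kept arms have indices below j because their means are revealed; the new group leaves those
   untouched. *)
have acc_lt b : b \in acc -> m' b.1 = m b.1.
  move=> /vacc[p [mb _ _ _]]; apply: hlt; rewrite ltnNge; apply/negP => jb.
  by rewrite mN in mb.
have -> : \prod_(b <- acc) ratio m U ell b = \prod_(b <- acc) ratio m' U ell b.
  by rewrite !big_seq; apply: eq_bigr => b /acc_lt; rewrite /ratio /mean => ->.
have := IH a.1.+1 (a :: acc) m'; rewrite big_cons [ratio _ _ _ a * _]mulrC mulrA.
apply => //.
- move=> b; rewrite inE => /orP[/eqP ->//|bacc].
  have [p [mb p01 bl l0]] := vacc _ bacc.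
  by exists p; split; rewrite ?acc_lt.
- by move=> m2 l sl; apply: hk; rewrite sl /= addnS.
Qed.

End Screening.

(** * The one-step potential inequality *)

Section Potential.
Context {R : realType}.

(** As d tends to 0 the coefficient tends to the 1/2 of the Taylor formula, which the final constant
    requires. *)
Lemma expR_le_quadratic (d x : R) : 0 <= d -> x <= d ->
  expR x <= 1 + x + expR d * x ^+ 2 / 2.
Proof.
move=> d0 xd; pose f (y : R) := 1 + y + expR d / 2 * y ^+ 2 - expR y.
pose df (y : R) := 1 + expR d * y - expR y.
have fD (y : R) : is_derive y 1 f (df y).
  rewrite /f /df; apply: is_derive_eq; rewrite /GRing.scale /=.
  by field.
have fC (a b : R) : {within `[a, b], continuous f}.
  apply: continuous_subspaceT => y.
  by apply: differentiable_continuous; apply/derivable1_diffP; case: (fD y).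
have f0 : f 0 = 0 by rewrite /f expR0; ring.
suff : 0 <= f x by rewrite /f; lra.
have Kge1 : 1 <= expR d by rewrite -expR0 ler_expR.
have [x0|x0] := leP 0 x.
- have [c] := MVT_segment x0 (fun y _ => fD y) (fC 0 x).
  rewrite in_itv /= f0 !subr0 => /andP[c0 cx] ->; rewrite mulr_ge0// /df.
  have := expR_ge1Dx (- c); rewrite expRN => h.
  have : expR c * (1 - c) <= 1.
    by have := ler_wpM2l (expR_ge0 c) h; rewrite divff// expR_eq0.
  have : expR c <= expR d by rewrite ler_expR (le_trans cx).
  nra.
- have [c] := MVT_segment (ltW x0) (fun y _ => fD y) (fC x 0).
  rewrite in_itv /= f0 sub0r => /andP[xc c0] e.
  have : df c <= 0.
    by rewrite /df; have := expR_ge1Dx c; nra.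
  by move: e x0; nra.
Qed.

(** The Laplace estimate: the probability of success of the next reward under the mixture, and a
    martingale under it. *)
Definition est (s t : nat) : R := s.+1%:R / t.+2%:R.

Lemma est01 s t : (s <= t)%N -> 0 <= est s t <= 1.
Proof.
move=> st; rewrite /est divr_ge0//= ler_pdivrMr ?ltr0n// mul1r ler_nat.
by rewrite ltnS leqW.
Qed.

Lemma est_succ s t : est s.+1 t.+1 = est s t + (1 - est s t) / t.+3%:R.
Proof.
have h1 : t.+2%:R != 0 :> R by rewrite pnatr_eq0.
have h2 : t.+2%:R + 1 != 0 :> R by rewrite natr1 pnatr_eq0.
rewrite /est -[s.+2%:R]natr1 -[t.+3%:R]natr1.
by move: (t.+2%:R) (s.+1%:R) h1 h2 => T S h1 h2; field; rewrite h1 h2.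
Qed.

Lemma est_fail s t : est s t.+1 = est s t - est s t / t.+3%:R.
Proof.
have h1 : t.+2%:R != 0 :> R by rewrite pnatr_eq0.
have h2 : t.+2%:R + 1 != 0 :> R by rewrite natr1 pnatr_eq0.
rewrite /est -[t.+3%:R]natr1.
by move: (t.+2%:R) (s.+1%:R) h1 h2 => T S h1 h2; field; rewrite h1 h2.
Qed.

(** An exponential supermartingale weighted by the mixture. The term b kappa^2 / (t+2) is a reserve
    for the variance of all later samples, a sum of 1/(u+3)^2 over u >= t. *)
Definition pot (F : R -> R) (b kappa : R) (s t : nat) : R :=
  mix s t * expR (- (kappa * F (est s t)) + b * kappa ^+ 2 / t.+2%:R).

Lemma pot_ge0 F b kappa s t : 0 <= pot F b kappa s t.
Proof. by rewrite mulr_ge0 ?expR_ge0// ltW// mix_gt0. Qed.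

(* F' is bounded by the inverse standard deviation of a Bernoulli variable, so
   under the Laplace rule an increment of F has variance at most 1/(t+3)^2. *)
Lemma pot_step (F F1 : R -> R) (B1 B2 b d kappa : R) (s t : nat) :
  (forall x y, 0 <= x <= 1 -> 0 <= y <= 1 ->
     F x + F1 x * (y - x) - B2 * (y - x) ^+ 2 <= F y) ->
  (forall x, 0 <= x <= 1 -> 0 <= F1 x <= B1) ->
  (forall x, 0 <= x <= 1 -> F1 x ^+ 2 * (x * (1 - x)) <= 1) ->
  0 <= d -> 0 <= B2 -> 0 <= kappa -> kappa * B1 <= d * t.+3%:R ->
  B2 <= (b - expR d / 2) * kappa -> (s <= t)%N ->
  pot F b kappa s.+1 t.+1 + pot F b kappa s t.+1 <= pot F b kappa s t.
Proof.
move=> taylor F1B F1sq d0 B20 k0 kB1 kB2 st.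
have x01 := est01 s t st; have y1_01 := est01 s.+1 t.+1 (st : (s.+1 <= t.+1)%N).
have y0_01 := est01 s t.+1 (leqW st).
rewrite /pot mix_succ// mix_fail// -/(est s t).
move: (taylor _ _ x01 y1_01) (taylor _ _ x01 y0_01) (F1B _ x01) (F1sq _ x01).
rewrite est_succ est_fail; set x := est s t in x01 *.
have T3 : 0 < t.+3%:R :> R by rewrite ltr0n.
set T : R := t.+3%:R in kB1 T3 *.
have T2E : t.+2%:R = T - 1 by rewrite /T -[t.+3%:R]natr1; ring.
have T2 : 0 < T - 1 by rewrite -T2E ltr0n.
rewrite T2E; set y1 := F (x + (1 - x) / T); set y0 := F (x - x / T).
set D := F1 x; move=> h1 h0 /andP[D0 DB] Dsq.
have /andP[x0 x1] := x01.
pose a := kappa * D / T.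
have a0 : 0 <= a by rewrite /a !mulr_ge0// ltW// invr_gt0.
have ad : a <= d.
  by rewrite /a ler_pdivrMr// (le_trans _ kB1)// ler_wpM2l.
pose c := kappa * B2 / T ^+ 2.
have c_ge0 : 0 <= kappa * B2 * (T^-1) ^+ 2 by rewrite mulr_ge0 ?sqr_ge0// mulr_ge0.
have e1 : - (kappa * y1) <= - (kappa * F x) + (c + - (a * (1 - x))).
  have : kappa * (F x + D * (x + (1 - x) / T - x) - B2 * (x + (1 - x) / T - x) ^+ 2)
      <= kappa * y1 by rewrite ler_wpM2l.
  have -> : x + (1 - x) / T - x = (1 - x) / T by ring.
  have : kappa * B2 * (T^-1) ^+ 2 * (1 - x) ^+ 2 <= kappa * B2 * (T^-1) ^+ 2.
    by rewrite ler_piMr// exprn_ile1 ?subr_ge0// gerBl.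
  by rewrite /a /c -exprVn; move: (T^-1) => i; lra.
have e0 : - (kappa * y0) <= - (kappa * F x) + (c + a * x).
  have : kappa * (F x + D * (x - x / T - x) - B2 * (x - x / T - x) ^+ 2)
      <= kappa * y0 by rewrite ler_wpM2l.
  have -> : x - x / T - x = - (x / T) by ring.
  have : kappa * B2 * (T^-1) ^+ 2 * x ^+ 2 <= kappa * B2 * (T^-1) ^+ 2.
    by rewrite ler_piMr// exprn_ile1.
  by rewrite /a /c -exprVn; move: (T^-1) => i; lra.
pose K := expR d.
have K0 : 0 <= K by exact: expR_ge0.
have q1 := expR_le_quadratic d (- (a * (1 - x))) d0.
have q0 := expR_le_quadratic d (a * x) d0.
have {}q1 : expR (- (a * (1 - x))) <= 1 - a * (1 - x) + K * (a * (1 - x)) ^+ 2 / 2.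
  by rewrite -[(a * _) ^+ 2]sqrrN; apply: q1; rewrite (le_trans _ d0)// oppr_le0 mulr_ge0// subr_ge0.
have {}q0 : expR (a * x) <= 1 + a * x + K * (a * x) ^+ 2 / 2.
  by apply: q0; rewrite (le_trans _ ad)// ler_piMr.
(* The terms linear in a cancel, the estimate being a martingale; the speed bound on F' disposes of
   x (1 - x). *)
have qq : x * expR (- (a * (1 - x))) + (1 - x) * expR (a * x)
    <= expR (K / 2 * kappa ^+ 2 / T ^+ 2).
  apply: (@le_trans _ _ (1 + K / 2 * a ^+ 2 * (x * (1 - x)))).
    have := ler_wpM2l x0 q1; have x1' : 0 <= 1 - x by rewrite subr_ge0.
    have := ler_wpM2l x1' q0; lra.
  apply: le_trans (expR_ge1Dx _) _; rewrite ler_expR.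
  have -> : K / 2 * a ^+ 2 * (x * (1 - x))
      = K / 2 * kappa ^+ 2 / T ^+ 2 * (D ^+ 2 * (x * (1 - x))).
    by rewrite /a; field; rewrite gt_eqF.
  by rewrite ler_piMr// !mulr_ge0// ?exprn_ge0// ?invr_ge0 ?exprn_ge0// ltW.
(* One step of the reserve: 1/T^2 <= 1/(T-1) - 1/T. The gap between b and K/2 absorbs the Taylor
   remainder c. *)
have fin : K / 2 * kappa ^+ 2 / T ^+ 2 + c + b * kappa ^+ 2 / T
    <= b * kappa ^+ 2 / (T - 1).
  have h : (K / 2 * kappa ^+ 2 + kappa * B2) <= b * kappa ^+ 2.
    by have := ler_wpM2l k0 kB2; rewrite -/K; lra.
  have bk : 0 <= b * kappa ^+ 2 by apply: le_trans h; rewrite addr_ge0 ?mulr_ge0 ?divr_ge0 ?exprn_ge0.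
  have -> : b * kappa ^+ 2 / (T - 1)
      = b * kappa ^+ 2 / T + b * kappa ^+ 2 / (T * (T - 1)).
    by field; rewrite !gt_eqF.
  rewrite /c -mulrDl addrC lerD2l.
  apply: (@le_trans _ _ (b * kappa ^+ 2 / T ^+ 2)).
    by rewrite ler_pM2r// invr_gt0 exprn_gt0.
  rewrite ler_wpM2l// lef_pV2 ?posrE ?mulr_gt0 ?exprn_gt0// expr2 ler_pM2l//.
  by rewrite gerBl.
set Z := b * kappa ^+ 2 / T in fin *.
apply: (@le_trans _ _ (mix s t * (expR (- (kappa * F x) + c + Z)
   * (x * expR (- (a * (1 - x))) + (1 - x) * expR (a * x))))).
  rewrite -[mix s t * x * _]mulrA -[mix s t * (1 - x) * _]mulrA -mulrDr.
  rewrite ler_wpM2l ?(ltW (mix_gt0 _ _))// mulrDr mulrCA [X in _ <= _ + X]mulrCA.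
  apply: lerD; rewrite ler_wpM2l ?subr_ge0// -expRD ler_expR; lra.
rewrite ler_wpM2l ?(ltW (mix_gt0 _ _))//.
apply: (@le_trans _ _ (expR (- (kappa * F x) + c + Z)
    * expR (K / 2 * kappa ^+ 2 / T ^+ 2))).
  by rewrite ler_wpM2l ?expR_ge0.
rewrite -expRD ler_expR; move: fin.
set P := K / 2 * _ / _; set Q := _ / (T - 1); clearbody P Q Z c.
by lra.
Qed.

End Potential.

(** * Successive rejects *)

Section Rejects.
Context {R : realType} (mu : probability R R) (beta : R).
Local Notation prog_low := (prog_low mu beta).
Variables (F : R -> R) (b lam A X0 C0 : R) (tau : nat -> nat) (M1 : nat).
Local Notation U M := (pot F b (lam / M%:R)).
Hypotheses (lam0 : 0 <= lam) (b0 : 0 <= b) (A0 : 0 < A) (C00 : 0 <= C0)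
  (F_mono : forall x y, 0 <= x -> x <= y -> y <= 1 -> F x <= F y)
  (step : forall M s t, (M < M1)%N -> (s <= t)%N -> X0 <= M.+1%:R * t%:R ->
    U M.+1 s.+1 t.+1 + U M.+1 s t.+1 <= U M.+1 s t)
  (tau_dec : forall i, (tau i.+2 <= tau i.+1)%N)
  (tauX : forall M, X0 <= M.+1%:R * (tau M.+2)%:R)
  (tauA : forall M, A <= M.+1%:R * (tau M.+1)%:R)
  (final : forall p s, 0 <= p < beta -> p <= 1 -> (s <= tau 1)%N ->
    lik p s (tau 1) <= C0 * pot F b lam s (tau 1)).

(** Each dropped arm costs a factor tau + 1 for its mixture and, as kappa rises from lam/(M'+2) to
    lam/(M'+1), an increase of the total reserve by at most b lam^2 / (A (M'+1)). These increases
    add up to a harmonic sum. *)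
Fixpoint rejC (M : nat) : R :=
  if M is M'.+1 then
    rejC M' * ((tau M'.+2).+1%:R * expR (b * lam ^+ 2 / (A * M'.+1%:R)))
  else C0.

Lemma rejC_ge0 M : 0 <= rejC M.
Proof. by elim: M => [//|M IH] /=; rewrite !mulr_ge0 ?expR_ge0. Qed.

Lemma prod_ratio_pot m t kappa (l : seq (nat * nat)) :
  \prod_(a <- l) ratio m (pot F b kappa) t a =
  \prod_(a <- l) (mix a.2 t / lik (mean m a) a.2 t) *
  expR (- (kappa * \sum_(a <- l) F (est a.2 t))
        + (size l)%:R * (b * kappa ^+ 2 / t.+2%:R)).
Proof.
elim: l => [|a l IH]; first by rewrite !big_nil mulr0 oppr0 mul0r add0r expR0 mulr1.
rewrite !big_cons IH /ratio /pot /= -[(size l).+1%:R]natr1.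
set E := b * kappa ^+ 2 / t.+2%:R; set S := \sum_(_ <- _) _.
have -> : - (kappa * (F (est a.2 t) + S)) + ((size l)%:R + 1) * E =
  (- (kappa * F (est a.2 t)) + E) + (- (kappa * S) + (size l)%:R * E) by ring.
by rewrite [in RHS]expRD; ring.
Qed.

(* Dropping the worst arm raises the average of F over the surviving arms. *)
Lemma drop_worst M l m : size l = M.+2 ->
  {in l, forall a, valid m (tau M.+2) a} ->
  rejC M * \prod_(a <- behead (sort fewest_successes l))
             ratio m (U M.+1) (tau M.+2) a
  <= rejC M.+1 * \prod_(a <- l) ratio m (U M.+2) (tau M.+2) a.
Proof.
move=> sl vl; set t := tau M.+2.
have tot : total fewest_successes by move=> x y; exact: leq_total.
have tr : transitive fewest_successes by move=> y x z; exact: leq_trans.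
have := sort_sorted tot l; have := permEl (perm_sort fewest_successes l).
case E : (sort _ _) => [|x l'] pm /=.
  by move: (perm_size pm); rewrite sl.
move=> /(order_path_min tr)/allP xmin.
have vl' : {in x :: l', forall a, valid m t a}.
  by move=> a; rewrite (perm_mem pm); exact: vl.
rewrite -(perm_big _ pm) /= !prod_ratio_pot big_cons.
have sl' : size l' = M.+1 by move: (perm_size pm); rewrite sl => -[].
rewrite [size (x :: l')]/= sl' big_cons.
set PR := \prod_(a <- l') _; set S := \sum_(a <- l') _.
have PR0 : 0 <= PR.
  rewrite /PR big_seq prodr_ge0// => a al'.
  have /vl'/valid_mean[_ _ /ltW l0] : a \in x :: l' by rewrite inE al' orbT.
  by rewrite divr_ge0// ltW// mix_gt0.
have [p01 xt lx0] := valid_mean _ _ _ (vl' x (mem_head _ _)).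
(* The dropped arm leaves the product, where its mixture quotient was at least 1/(t+1). *)
have rx : 1 <= t.+1%:R * (mix x.2 t / lik (mean m x) x.2 t).
  by rewrite mulrA ler_pdivlMr// mul1r lik_le_mix.
have Sx : M.+1%:R * F (est x.2 t) <= S.
  have -> : M.+1%:R * F (est x.2 t) = \sum_(a <- l') F (est x.2 t).
    by rewrite big_const_seq iter_addr_0 count_predT sl' mulr_natl.
  rewrite /S !big_seq; apply: ler_sum => a al'.
  have /vl'/valid_mean[_ at_ _] : a \in x :: l' by rewrite inE al' orbT.
  have /andP[ax0 _] := @est01 R x.2 t xt; have /andP[_ aa1] := @est01 R a.2 t at_.
  apply: F_mono => //; rewrite /est ler_pM2r ?invr_gt0 ?ltr0n// ler_nat ltnS.
  exact: xmin.
rewrite /= -/t.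
set G1 := expR (_ + _); set G2 := expR (b * lam ^+ 2 / _); set G3 := expR (_ + _).
set r := mix x.2 t / _ in rx *; clearbody r.
rewrite -!mulrA ler_wpM2l ?rejC_ge0//.
suff G123 : G1 <= G2 * G3.
  apply: (@le_trans _ _ (PR * (G2 * G3))); first by rewrite ler_wpM2l.
  have -> : t.+1%:R * (G2 * (r * (PR * G3)))
     = t.+1%:R * r * (PR * (G2 * G3)) by ring.
  by rewrite ler_peMl// !mulr_ge0// ?expR_ge0.
rewrite /G1 /G2 /G3 -expRD ler_expR -[M.+2%:R]natr1.
have m0 : 0 < M.+1%:R :> R by rewrite ltr0n.
have At : A <= (M.+1%:R + 1) * t.+2%:R.
  by rewrite natr1 (le_trans (tauA M.+1))// ler_wpM2l// ler_nat leqW.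
have T0 : 0 < t.+2%:R :> R by rewrite ltr0n.
move: Sx m0 At T0; move: (M.+1%:R) (t.+2%:R) (F _) => k T f Sx k0 At T0.
have k1 : 0 < k + 1 by rewrite addr_gt0.
have h1 : lam / (k + 1) * (f + S) <= lam / k * S.
  rewrite -subr_ge0.
  have -> : lam / k * S - lam / (k + 1) * (f + S)
      = lam * (S - k * f) / (k * (k + 1)) by field; rewrite !gt_eqF.
  by rewrite !mulr_ge0 ?subr_ge0// invr_ge0 mulr_ge0// ltW.
have h2 : k * (b * (lam / k) ^+ 2 / T) <=
    b * lam ^+ 2 / (A * k) + (k + 1) * (b * (lam / (k + 1)) ^+ 2 / T).
  have -> : k * (b * (lam / k) ^+ 2 / T) =
      b * lam ^+ 2 / (((k + 1) * T) * k) + (k + 1) * (b * (lam / (k + 1)) ^+ 2 / T).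
    by field; rewrite !gt_eqF.
  rewrite lerD2r ler_wpM2l ?mulr_ge0// ?sqr_ge0//.
  by rewrite lef_pV2 ?posrE ?mulr_gt0// ler_pM2r.
lra.
Qed.

Lemma rejects_le M l t m : (M < M1)%N -> size l = M.+1 ->
  {in l, forall a, valid m t a} -> (t <= tau M.+1)%N ->
  X0 <= M.+1%:R * t%:R ->
  (prog_low (rejects tau M l t) m <=
    (rejC M * \prod_(a <- l) ratio m (U M.+1) t a)%:E)%E.
Proof.
have tauX' (i u u' : nat) : X0 <= i.+1%:R * u%:R -> (u <= u')%N ->
    X0 <= i.+1%:R * u'%:R :> R.
  by move=> h tt'; rewrite (le_trans h)// ler_wpM2l// ler_nat.
elim: M l t => [|M IH] l t MM1 sl vl tt Xt.
- rewrite /rejects; have := @smpl_le _ mu beta m (U 1) l (tau 1 - t) [::] t C0.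
  rewrite big_nil mulr1; apply => //.
  + by move=> s' t'; exact: pot_ge0.
  + by move=> s' t' st tt'; apply: step => //; exact: tauX' tt'.
  + rewrite subnKC// sl => -[//|a [|//]] _ va; rewrite big_seq1 /=.
    have [p [ma p01 at1 l0]] := va a (mem_head _ _).
    have /andP[p0 p1] := p01.
    rewrite /= ma /= /ratio /mean ma /= invr1 mulr1.
    case: ifPn => pb; last by rewrite lee_fin mulr_ge0// divr_ge0 ?pot_ge0 1?ltW.
    by rewrite lee_fin mulrA ler_pdivlMr// mul1r; apply: final => //; rewrite p0.
- rewrite /rejects -/rejects.
  have := @smpl_le _ mu beta m (U M.+2) l (tau M.+2 - t) [::] t (rejC M.+1).
  rewrite big_nil mulr1; apply => //.
  + by move=> s' t'; exact: pot_ge0.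
  + by move=> s' t' st tt'; apply: step => //; exact: tauX' tt'.
  + exact: rejC_ge0.
  + rewrite subnKC// sl addn0 => l' sl' vl'.
    apply: le_trans (IH _ _ _ _ _ _ _) _ => //; first exact: ltnW.
    * by rewrite size_behead size_sort sl'.
    * move=> a /mem_behead; rewrite mem_sort; exact: vl'.
    * by rewrite lee_fin drop_worst.
Qed.

End Rejects.

(** * The last arm *)

Section Final.
Context {R : realType}.

(** If the estimate is at most beta, monotonicity of F and the mixture bound suffice. Otherwise an
    arm of mean p < beta looks better than beta: the Chernoff parameter u = lam B1 / (t+2) makes
    e^(-us) offset the largest possible growth of lam F, at a second-order cost t u^2 <= (lam B1)^2
    / t. *)
Lemma lik_low_mean (F : R -> R) (b lam B1 beta p : R) (s t : nat) :
  (forall x y, 0 <= x -> x <= y -> y <= 1 -> F x <= F y <= F x + B1 * (y - x)) ->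
  0 <= b -> 0 <= lam -> 0 <= B1 -> 0 <= beta <= 1 -> 0 <= p < beta -> p <= 1 ->
  (s <= t)%N -> (0 < t)%N -> lam * B1 <= t%:R / 2 ->
  lik p s t <= (t.+1%:R * expR (lam * F beta + (lam * B1) ^+ 2 / t%:R + 1))
                * pot F b lam s t.
Proof.
move=> FB b0 lam0 B10 /andP[be0 be1] /andP[p0 pb] p1 st t0 lamt.
have T0 : 0 < t%:R :> R by rewrite ltr0n.
have T2 : 0 < t.+2%:R :> R by rewrite ltr0n.
have p01 : 0 <= p <= 1 by rewrite p0.
set q := (lam * B1) ^+ 2 / t%:R.
have q0 : 0 <= q by rewrite divr_ge0// sqr_ge0.
have bl0 : 0 <= b * lam ^+ 2 / t.+2%:R.
  by rewrite !mulr_ge0// invr_ge0 ltW.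
have /andP[x0 x1] := @est01 R s t st.
rewrite /pot mulrACA -expRD.
have mm0 : 0 <= t.+1%:R * mix s t :> R by rewrite mulr_ge0// ltW// mix_gt0.
case: (leP (est s t) beta) => xb.
  apply: le_trans (lik_le_mix p s t p01 st) _; rewrite ler_peMr//.
  have /andP[h _] := FB _ _ x0 xb be1.
  rewrite -[leLHS]expR0 ler_expR; have := ler_wpM2l lam0 h.
  by move: bl0; set Bl := b * _ / _; clearbody Bl q; lra.
pose u := lam * B1 / t.+2%:R.
have u0 : 0 <= u by rewrite divr_ge0 ?mulr_ge0// ltW.
have u1 : u <= 2^-1.
  by rewrite ler_pdivrMr// (le_trans lamt)// mulrC ler_pM2l// ler_nat leqW.
apply: le_trans (lik_chernoff p u s t p01 st) _; rewrite ler_wpM2l//.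
apply: (@le_trans _ _ (expR (- (u * s%:R)) * expR (t%:R * (beta * (u + u ^+ 2))))).
  rewrite ler_wpM2l ?expR_ge0// expRM_natl lerXn2r ?nnegrE ?expR_ge0//.
    by rewrite addr_ge0 ?subr_ge0// mulr_ge0 ?expR_ge0.
  apply: le_trans (expR_ge1Dx _).
  have e2 : expR u <= 1 + u + u ^+ 2.
    have h0 : 0 <= 2^-1 :> R by rewrite invr_ge0.
    have := expR_le_quadratic (2^-1) u h0 u1.
    have : expR (2^-1) <= 2 :> R.
      have := expR_ge1Dx (- 2^-1 : R); rewrite expRN => h.
      rewrite -[leRHS]invrK -[leLHS]invrK lef_pV2 ?posrE ?invr_gt0 ?expR_gt0//.
      by apply: le_trans h; lra.
    have := sqr_ge0 u; nra.
  have e1 : 1 <= expR u by rewrite -expR0 ler_expR.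
  have : p * (expR u - 1) <= beta * (expR u - 1) by rewrite ler_wpM2r ?subr_ge0// ltW.
  have : beta * (expR u - 1) <= beta * (u + u ^+ 2) by rewrite ler_wpM2l//; lra.
  lra.
rewrite -expRD ler_expR.
have /andP[_ h] := FB _ _ be0 (ltW xb) x1.
have hF : lam * F (est s t) <= lam * F beta + u * (s%:R + 1 - t.+2%:R * beta).
  apply: le_trans (ler_wpM2l lam0 h) _.
  rewrite mulrDr lerD2l /u /est natr1 le_eqVlt; apply/orP; left; apply/eqP.
  by field; rewrite gt_eqF.
have huu : t%:R * (beta * u ^+ 2) <= q.
  have uw : u <= lam * B1 / t%:R.
    by rewrite ler_wpM2l ?mulr_ge0// lef_pV2 ?posrE// ler_nat leqW.
  have -> : q = t%:R * (1 * (lam * B1 / t%:R) ^+ 2).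
    by rewrite /q; field; rewrite gt_eqF.
  by rewrite ler_wpM2l// ler_pM ?sqr_ge0// lerXn2r ?nnegrE ?divr_ge0 ?mulr_ge0.
have : u * (t.+2%:R * beta) >= u * (t%:R * beta).
  by rewrite ler_wpM2l// ler_wpM2r// ler_nat leqW.
have ub : u <= 1 by apply: le_trans u1 _; rewrite invf_le1// ler1n.
move: bl0 hF huu ub; set Bl := b * _ / _; set T := t.+2%:R; set S := s%:R.
by clearbody Bl q T S u; lra.
Qed.
End Final.

(** * Smoothed arc length *)

(* For r < 1 the function below is a smoothing of arccos (1 - 2 x) with bounded
   derivatives on the whole of [0, 1], still of speed at most 1/sqrt (x (1-x)). *)
Section ArcFunction.
Context {R : realType} (r : R).
Hypothesis r01 : 0 < r < 1.
Implicit Types x y c : R.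

Definition arcF (x : R) : R := acos (r * (1 - 2 * x)).

Let w (x : R) : R := 1 - (r * (1 - 2 * x)) ^+ 2.

Definition arcF1 (x : R) : R := 2 * r / Num.sqrt (w x).

Let w0 : R := Num.sqrt (1 - r ^+ 2).

Definition arcB1 : R := 2 / w0.
Definition arcB2 : R := 4 / w0 ^+ 3.

Let w0_gt0 : 0 < w0.
Proof. by rewrite /w0 sqrtr_gt0; have /andP[? ?] := r01; nra. Qed.

Let arg_bound x : 0 <= x <= 1 -> -1 < r * (1 - 2 * x) < 1.
Proof. by have /andP[? ?] := r01 => /andP[? ?]; apply/andP; split; nra. Qed.

Let w_ge x : 0 <= x <= 1 -> w0 <= Num.sqrt (w x).
Proof.
move=> /andP[x0 x1]; rewrite /w0 ler_wsqrtr// /w exprMn lerD2l lerN2.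
rewrite ler_piMr ?sqr_ge0//; nra.
Qed.

Let w_gt0 x : 0 <= x <= 1 -> 0 < Num.sqrt (w x).
Proof. by move=> x01; apply: lt_le_trans (w_ge _ x01). Qed.

Let sqr_w x : 0 <= x <= 1 -> Num.sqrt (w x) ^+ 2 = w x.
Proof. by move=> /w_gt0; rewrite sqrtr_gt0 => /ltW; exact: sqr_sqrtr. Qed.

Lemma arcB1_gt0 : 0 < arcB1.
Proof. by rewrite divr_gt0. Qed.

Lemma arcB2_gt0 : 0 < arcB2.
Proof. by rewrite divr_gt0 ?exprn_gt0. Qed.

Lemma arcF1_bound x : 0 <= x <= 1 -> 0 <= arcF1 x <= arcB1.
Proof.
move=> x01; have /andP[r0 r1] := r01; have wx := w_gt0 _ x01.
apply/andP; split; first by rewrite divr_ge0 ?mulr_ge0 ?ltW.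
apply: (@le_trans _ _ (2 / Num.sqrt (w x))).
  by rewrite ler_pM2r ?invr_gt0//; lra.
by rewrite ler_pM2l// lef_pV2 ?posrE// w_ge.
Qed.

(** As (1 - 2x)^2 = 1 - 4x(1-x), the radicand is (1 - r^2) + 4 r^2 x(1-x), and only its second term
    is in the numerator. *)
Lemma arcF1_speed x : 0 <= x <= 1 -> arcF1 x ^+ 2 * (x * (1 - x)) <= 1.
Proof.
move=> x01; have /andP[r0 r1] := r01; have wx := w_gt0 _ x01.
rewrite /arcF1 expr_div_n mulrAC ler_pdivrMr ?exprn_gt0// sqr_w// /w mul1r.
by nra.
Qed.

Let arcF_derive (x : R) : 0 <= x <= 1 -> is_derive x 1 arcF (arcF1 x).
Proof.
move=> x01; have := is_derive1_acos (arg_bound _ x01) => d.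
have d2 : is_derive x 1 (fun x : R => r * (1 - 2 * x)) (- (2 * r)).
  by apply: is_derive_eq; rewrite /GRing.scale /=; ring.
have := @is_derive1_comp R (@acos R) (fun x : R => r * (1 - 2 * x)) x _ _ d d2.
have -> // : arcF1 x = - (Num.sqrt (1 - (r * (1 - 2 * x)) ^+ 2))^-1 * - (2 * r).
by rewrite mulrNN mulrC.
Qed.

Lemma arcF_MVT x y : 0 <= x -> x <= y -> y <= 1 ->
  exists2 c, x <= c <= y & arcF y - arcF x = arcF1 c * (y - x).
Proof.
move=> x0 xy y1; have D (c : R) : c \in `]x, y[ -> is_derive c 1 arcF (arcF1 c).
  rewrite in_itv /= => /andP[xc cy]; apply: arcF_derive.
  by rewrite (le_trans x0 (ltW xc)) (le_trans (ltW cy)).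
have C : {within `[x, y], continuous arcF}.
  apply: continuous_in_subspaceT => c; rewrite inE /= in_itv /= => /andP[xc cy].
  apply: differentiable_continuous; apply/derivable1_diffP.
  have c01 : 0 <= c <= 1 by rewrite (le_trans x0 xc) (le_trans cy).
  by case: (arcF_derive _ c01).
by have [c] := MVT_segment xy D C; rewrite in_itv /= => xcy e; exists c.
Qed.

Lemma arcF_lip x y : 0 <= x -> x <= y -> y <= 1 ->
  arcF x <= arcF y <= arcF x + arcB1 * (y - x).
Proof.
move=> x0 xy y1; have [c /andP[xc cy] e] := arcF_MVT _ _ x0 xy y1.
have c01 : 0 <= c <= 1 by rewrite (le_trans x0 xc) (le_trans cy).
have /andP[f0 fB] := arcF1_bound _ c01; have d0 : 0 <= y - x by rewrite subr_ge0.
have := ler_wpM2r d0 fB; have := mulr_ge0 f0 d0; lra.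
Qed.

Let arcF1_lip x y : 0 <= x <= 1 -> 0 <= y <= 1 ->
  `|arcF1 x - arcF1 y| <= arcB2 * `|x - y|.
Proof.
move=> x01 y01; have /andP[r0 r1] := r01.
have wx := w_gt0 _ x01; have wy := w_gt0 _ y01.
have wx' := w_ge _ x01; have wy' := w_ge _ y01.
have ex := sqr_w _ x01; have ey := sqr_w _ y01.
rewrite /arcF1; set a := Num.sqrt (w x) in wx wx' ex *.
set b := Num.sqrt (w y) in wy wy' ey *.
have -> : 2 * r / a - 2 * r / b = 8 * r ^+ 3 * (1 - x - y) * (y - x) / (a * b * (a + b)).
  have e : 4 * r ^+ 2 * (1 - x - y) * (y - x) = b ^+ 2 - a ^+ 2.
    by rewrite ex ey /w; ring.
  have -> : 8 * r ^+ 3 * (1 - x - y) * (y - x) = 2 * r * (b ^+ 2 - a ^+ 2).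
    by rewrite -e; ring.
  by field; rewrite !gt_eqF ?addr_gt0.
rewrite normrM normfV.
have ab0 : 0 < a * b * (a + b) by rewrite !mulr_gt0 ?addr_gt0.
have W : w0 ^+ 3 * 2 <= a * b * (a + b).
  have -> : w0 ^+ 3 * 2 = w0 * w0 * (w0 + w0) by ring.
  have w00 := ltW w0_gt0.
  by apply: ler_pM; rewrite ?mulr_ge0 ?addr_ge0 ?lerD// ler_pM.
rewrite [X in _ / X]gtr0_norm// ler_pdivrMr//.
have num : `|8 * r ^+ 3 * (1 - x - y) * (y - x)| <= 8 * `|x - y|.
  rewrite normrM [`|y - x|]distrC ler_wpM2r// -mulrA normrM ger0_norm//.
  rewrite -[leRHS]mulr1 ler_wpM2l// normrM mulr_ile1//.
    by rewrite ger0_norm ?exprn_ge0 ?exprn_ile1// ltW.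
  by rewrite ler_norml; have /andP[? ?] := x01; have /andP[? ?] := y01; lra.
apply: le_trans num _.
have -> : 8 * `|x - y| = arcB2 * `|x - y| * (w0 ^+ 3 * 2).
  by rewrite /arcB2; field; rewrite gt_eqF.
by rewrite ler_wpM2l// mulr_ge0// ltW// arcB2_gt0.
Qed.

Lemma arcF_taylor x y : 0 <= x <= 1 -> 0 <= y <= 1 ->
  arcF x + arcF1 x * (y - x) - arcB2 * (y - x) ^+ 2 <= arcF y.
Proof.
move=> x01 y01; have /andP[x0 x1] := x01; have /andP[y0 y1] := y01.
have B0 := ltW arcB2_gt0.
have key c : 0 <= c <= 1 -> `|x - c| <= `|x - y| ->
    arcF1 x * (y - x) - arcB2 * (y - x) ^+ 2 <= arcF1 c * (y - x).
  move=> c01 xcy.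
  have h : `|(arcF1 x - arcF1 c) * (y - x)| <= arcB2 * (y - x) ^+ 2.
    rewrite normrM -real_normK ?num_real// expr2 mulrA ler_wpM2r//.
    by rewrite (le_trans (arcF1_lip _ _ x01 c01))// ler_wpM2l// distrC [leRHS]distrC distrC.
  have := ler_norm ((arcF1 x - arcF1 c) * (y - x)); lra.
have [xy|/ltW yx] := leP x y.
- have [c /andP[xc cy] e] := arcF_MVT _ _ x0 xy y1.
  have c01 : 0 <= c <= 1 by rewrite (le_trans x0 xc) (le_trans cy).
  have := key c c01; rewrite !ler0_norm ?subr_le0//; lra.
- have [c /andP[xc cy] e] := arcF_MVT _ _ y0 yx x1.
  have c01 : 0 <= c <= 1 by rewrite (le_trans y0 xc) (le_trans cy).
  have := key c c01; rewrite !ger0_norm ?subr_ge0//; lra.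
Qed.

End ArcFunction.

(** * Choice of the parameters *)

(* For N ~ exp (k^4): kM k groups of k^6 + 1 arms are screened with k^6 samples
   per arm, which uses a fraction O(1/k) of the budget kN k; kA k is the product
   (number of arms left) * (samples per arm) kept up by successive rejects.  The
   exponents make kM log N << N/log^2 N << kM k^6, where kM log N is the price of
   the mixtures. *)
Definition kM (k : nat) : nat := 4 ^ (k ^ 4).
Definition kA (k : nat) : nat := kM k * k ^ 9.
Definition ktau (k i : nat) : nat := (kA k %/ i).+1.
Definition kN (k : nat) : nat :=
  kM k * ((k ^ 6).+1 * k ^ 6) + \sum_(i < kM k) ktau k i.+1.
(** The margin 1/k far exceeds the standard deviation of a mean of k^6 rewards, of order k^-3, yet
    changes F only by O(1/k). *)
Definition kthr {R : realType} (alpha : R) (k : nat) : nat :=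
  Num.truncn ((alpha - k%:R^-1) * (k ^ 6)%:R).
Definition kprog {R : realType} (alpha : R) (k : nat) : prog :=
  screen (kthr alpha k) (k ^ 6) (k ^ 6) (kM k) 0 [::]
    (fun l => rejects (ktau k) (kM k).-1 l (k ^ 6)).

Section Schedule.
Context {R : realType}.

Lemma kM_gt0 k : (0 < kM k)%N. Proof. by rewrite expn_gt0. Qed.

Lemma ktau_dec k i : (ktau k i.+2 <= ktau k i.+1)%N.
Proof. by rewrite ltnS leq_div2l. Qed.

Lemma ktau_start k : (0 < k)%N -> (k ^ 6 <= ktau k (kM k))%N.
Proof.
move=> k0; rewrite /ktau /kA mulnC mulnK ?kM_gt0// leqW//.
by rewrite leq_pexp2l.
Qed.

Lemma kprog_depth (alpha : R) k : (0 < k)%N -> depth_le (kprog alpha k) (kN k).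
Proof.
move=> k0; apply: screen_depth => l; rewrite addn0 => sl.
have sl' : size l = (kM k).-1.+1 by rewrite prednK ?kM_gt0.
have t0 : (k ^ 6 <= ktau k (kM k).-1.+1)%N by rewrite prednK ?kM_gt0// ktau_start.
have [d hd dle] := rejects_depth (ktau k) (kM k).-1 l (k ^ 6) sl' t0 (ktau_dec k).
apply: depth_leW hd; rewrite prednK ?kM_gt0// in dle.
by apply: leq_trans dle; rewrite leq_addr.
Qed.

Lemma kN_mono j k : (j < k)%N -> (kN j < kN k)%N.
Proof.
move=> jk; have k0 : (0 < k)%N by exact: leq_ltn_trans jk.
have M_le : (kM j <= kM k)%N by rewrite leq_pexp2l// leq_exp2r// ltnW.
have A_le : (kA j <= kA k)%N by rewrite leq_mul// leq_exp2r// ltnW.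
rewrite /kN -addSn; apply: leq_add.
  have e6 : (j ^ 6 < k ^ 6)%N by rewrite ltn_exp2r.
  apply: (@leq_ltn_trans (kM k * ((j ^ 6).+1 * j ^ 6))); first by rewrite leq_mul.
  rewrite ltn_pmul2l ?kM_gt0//.
  apply: (@leq_ltn_trans ((j ^ 6).+1 * k ^ 6)); first by rewrite leq_mul// ltnW.
  by rewrite ltn_pmul2r ?expn_gt0 ?k0.
rewrite -!(big_mkord xpredT (fun i => ktau _ i.+1)).
rewrite [leqRHS](big_cat_nat (n := kM j))//=; apply: leq_trans (leq_addr _ _).
by apply: leq_sum => i _; rewrite ltnS leq_div2r.
Qed.

Lemma kN_inj : injective kN.
Proof.
by move=> j k e; case: (ltngtP j k) => // /kN_mono; rewrite e ltnn.
Qed.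

Lemma ktauA k i : (kA k)%:R <= i.+1%:R * (ktau k i.+1)%:R :> R.
Proof. by rewrite -natrM ler_nat mulnC ltnW// ltn_ceil. Qed.

Lemma ktau_le k i : (ktau k i.+1)%:R <= (kA k)%:R / i.+1%:R + 1 :> R.
Proof.
by rewrite /ktau -natr1 lerD2r ler_pdivlMr// -natrM ler_nat leq_trunc_div.
Qed.

Lemma ln_le_subr1 (x : R) : 0 < x -> ln x <= x - 1.
Proof.
move=> x0; have := @le_ln1Dx R (x - 1).
by rewrite addrCA subrr addr0; apply; rewrite ltrBrDr addNr.
Qed.

Lemma harmonic_le_ln n : \sum_(i < n.+1) i.+1%:R^-1 <= 1 + ln n.+1%:R :> R.
Proof.
elim: n => [|n IH]; first by rewrite big_ord_recr big_ord0 /= invr1 ln1 add0r addr0.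
rewrite big_ord_recr /= (le_trans (lerD IH (lexx _)))// -addrA lerD2l.
have n1 : 0 < n.+1%:R :> R by rewrite ltr0n.
have n2 : 0 < n.+2%:R :> R by rewrite ltr0n.
have : ln (n.+1%:R / n.+2%:R) <= n.+1%:R / n.+2%:R - 1 :> R.
  by rewrite ln_le_subr1// divr_gt0.
rewrite ln_div ?posrE//.
have -> : n.+1%:R / n.+2%:R - 1 = - n.+2%:R^-1 :> R.
  rewrite -[n.+2%:R]natr1; move: (n.+1%:R) n1 => x x0; field.
  by rewrite gt_eqF// addr_gt0.
by move: (ln _) (ln _) (_^-1) => u v w; lra.
Qed.

Lemma ln4 : 1 <= ln (4 : R) <= 2.
Proof.
have -> : 4 = 2 ^+ 2 :> R by ring.
rewrite lnXn// mulr2n.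
have h1 := @ln_le_subr1 2 ltac:(by []).
have := @ln_le_subr1 (2^-1) ltac:(by rewrite invr_gt0).
by rewrite lnV ?posrE//; lra.
Qed.

Lemma ln_kM k : k%:R ^+ 4 <= ln ((kM k)%:R : R) <= 2 * k%:R ^+ 4.
Proof.
rewrite /kM natrX lnXn// -[ln _ *+ _]mulr_natr natrX.
have /andP[h1 h2] := ln4; have x0 : 0 <= k%:R ^+ 4 :> R by rewrite exprn_ge0.
by rewrite ler_wpM2r// -[leLHS]mul1r ler_wpM2r.
Qed.

End Schedule.

Section ScheduleFacts.
Context {R : realType} (k : nat).
Hypothesis k2 : (2 <= k)%N.
Local Notation x := (k%:R : R).
Local Notation L := (ln (kN k)%:R : R).
Local Notation A := ((kA k)%:R : R).
Local Notation M := ((kM k)%:R : R).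

Let k0 : (0 < k)%N. Proof. exact: ltnW. Qed.
Let x2 : 2 <= x. Proof. by rewrite ler_nat. Qed.
Let x1 : 1 <= x. Proof. by rewrite ler1n. Qed.
Let x0 : 0 < x. Proof. by rewrite ltr0n. Qed.
Let M0 : 0 < M. Proof. by rewrite ltr0n kM_gt0. Qed.

Lemma kA_E : A = M * x ^+ 9. Proof. by rewrite natrM natrX. Qed.

Let k6 : (4 <= k ^ 6)%N.
Proof. by apply: leq_trans (_ : 2 ^ 6 <= _)%N; rewrite ?leq_exp2r. Qed.

Let k6_gt0 : (0 < k ^ 6)%N. Proof. by rewrite expn_gt0 k0. Qed.

Lemma kN_gt0 : (0 < kN k)%N.
Proof. by rewrite addn_gt0 muln_gt0 kM_gt0 muln_gt0 k6_gt0. Qed.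

Let N0 : 0 < (kN k)%:R :> R. Proof. by rewrite ltr0n kN_gt0. Qed.

Let ln_le (m n : nat) : (0 < m)%N -> (m <= n)%N -> ln (m%:R : R) <= ln n%:R.
Proof.
by move=> m0 mn; rewrite ler_ln ?posrE ?ltr0n ?ler_nat// (leq_trans m0).
Qed.

(** The 4 makes room for the summand 1 of the harmonic bound, as ln 4 >= 1. *)
Lemma kN_ge4M : (4 * kM k <= kN k)%N.
Proof.
rewrite mulnC (leq_trans _ (leq_addr _ _))// leq_mul2l; apply/orP; right.
by rewrite (leq_trans k6)// leq_pmull.
Qed.

Lemma lnN_ge : x ^+ 4 <= L.
Proof.
have /andP[h _] := @ln_kM R k; apply: le_trans h _; apply: ln_le (kM_gt0 _) _.
by apply: leq_trans kN_ge4M; rewrite leq_pmull.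
Qed.

Lemma harmonic_le_lnN : \sum_(i < kM k) (i.+1%:R : R)^-1 <= L.
Proof.
have := @harmonic_le_ln R (kM k).-1; rewrite prednK ?kM_gt0// => h.
apply: le_trans h _; have /andP[l4 _] := @ln4 R.
apply: (@le_trans _ _ (ln 4 + ln M)); first by rewrite lerD2r.
by rewrite -lnM ?posrE// -natrM ln_le ?muln_gt0 ?kM_gt0// kN_ge4M.
Qed.

Lemma lnA_le : ln (A + 2) <= L.
Proof.
rewrite -natrD ln_le ?addn2//; apply: (@leq_trans (1 + (kA k).+1)) => //.
rewrite /kN leq_add//; first by rewrite muln_gt0 kM_gt0 muln_gt0 k6_gt0.
by rewrite (bigD1 (Ordinal (kM_gt0 k)))//= /ktau divn1 leq_addr.
Qed.

Lemma lng_le : ln (x ^+ 6 + 1) <= L.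
Proof.
rewrite -natrX natr1 ln_le// (leq_trans _ (leq_addr _ _))// mulnCA leq_pmulr//.
by rewrite muln_gt0 kM_gt0 k6_gt0.
Qed.

Let screen_cost : (kM k * ((k ^ 6).+1 * k ^ 6))%:R <= 2 * M * x ^+ 12.
Proof.
rewrite natrM [((_).+1 * _)%:R]natrM -natr1 natrX.
have : 1 <= x ^+ 6 by rewrite exprn_ege1.
have -> : x ^+ 12 = x ^+ 6 * x ^+ 6 by rewrite -exprD.
move: (x ^+ 6) M0 => y m0 y1.
have : 0 <= M * (y * (y - 1)).
  by rewrite !mulr_ge0 ?subr_ge0// ?(le_trans _ y1)// ltW.
by lra.
Qed.

(** Successive rejects use A times a harmonic sum, up to rounding; screening uses at most 2 M x^12,
    a fraction of order 1/x of A L >= M x^13. *)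
Lemma kN_le : (kN k)%:R <= A * L * (1 + 3 / x).
Proof.
have h : (kN k)%:R <= 2 * M * x ^+ 12 + (A * L + M).
  rewrite [leLHS]natrD lerD//; apply: (@le_trans _ _ (A * \sum_(i < kM k) (i.+1%:R : R)^-1 + M)).
    rewrite natr_sum mulr_sumr.
    have -> : M = \sum_(i < kM k) 1 by rewrite sumr_const card_ord.
    by rewrite -big_split; apply: ler_sum => i _; exact: ktau_le.
  by apply: lerD => //; apply: ler_wpM2l => //; exact: harmonic_le_lnN.
apply: le_trans h _.
have -> : A * L * (1 + 3 / x) = A * L + 3 * M * x ^+ 8 * L.
  by rewrite kA_E; field; rewrite gt_eqF.
have : M <= M * x ^+ 12 by rewrite ler_peMr ?(ltW M0) ?exprn_ege1.
have : M * x ^+ 8 * x ^+ 4 <= M * x ^+ 8 * L.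
  by rewrite ler_wpM2l ?lnN_ge// mulr_ge0 ?exprn_ge0// ltW.
have -> : M * x ^+ 8 * x ^+ 4 = M * x ^+ 12 by rewrite -mulrA -exprD.
by move: (x ^+ 12) (x ^+ 8) (A * L) => u v w; lra.
Qed.

Lemma lnN_le : L <= 8 * x ^+ 4.
Proof.
have h : (kN k)%:R <= 4 * (M ^+ 2 * x ^+ 12).
  have Mx : M <= A by rewrite kA_E ler_peMr ?(ltW M0) ?exprn_ege1.
  have : \sum_(i < kM k) (ktau k i.+1)%:R <= \sum_(i < kM k) (2 * A).
    apply: ler_sum => i _; apply: le_trans (ktau_le _ _) _.
    have : A / i.+1%:R <= A by rewrite ler_pdivrMr// ler_peMr// ler1n.
    have : 1 <= A by apply: le_trans Mx; rewrite ler1n kM_gt0.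
    by move: (A / _) => z; lra.
  rewrite sumr_const card_ord -mulr_natl => hs.
  rewrite natrD natr_sum; apply: le_trans (lerD screen_cost hs) _.
  have m1 : 1 <= M by rewrite ler1n kM_gt0.
  have y1 : 1 <= x ^+ 3 by rewrite exprn_ege1.
  have y0 : 0 <= x ^+ 9 by rewrite exprn_ge0// ltW.
  rewrite kA_E; have -> : x ^+ 12 = x ^+ 9 * x ^+ 3 by rewrite -exprD.
  have a1 : M * x ^+ 9 * x ^+ 3 <= M * (M * x ^+ 9 * x ^+ 3).
    by rewrite ler_peMl// !mulr_ge0// ?(ltW M0)// ltW// exprn_gt0.
  have a2 : M * (M * x ^+ 9) <= M * (M * x ^+ 9) * x ^+ 3.
    by rewrite ler_peMr// !mulr_ge0// ltW.
  by move: a1 a2; move: (x ^+ 9) (x ^+ 3) => u v; lra.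
have : L <= ln (4 * (M ^+ 2 * x ^+ 12)).
  by rewrite ler_ln ?posrE ?mulr_gt0 ?exprn_gt0.
rewrite lnM ?posrE ?mulr_gt0 ?exprn_gt0//.
rewrite [ln (_ * _)]lnM ?posrE ?exprn_gt0// lnXn// lnXn//.
have /andP[_ l4] := @ln4 R; have /andP[_ lM] := @ln_kM R k.
have lx : ln x <= x by rewrite ltW// ln_sublinear.
rewrite -[ln M *+ 2]mulr_natr -[ln x *+ 12]mulr_natr.
have : 8 * x <= x ^+ 4.
  have -> : x ^+ 4 = x ^+ 3 * x by rewrite -exprSr.
  rewrite ler_pM2r// (_ : 8 = 2 ^+ 3); last by ring.
  by rewrite lerXn2r ?nnegrE// ltW.
move: x2 l4 lM lx; move: (ln 4) (ln M) (ln x) => a b c; move: (x ^+ 4) => y.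
by lra.
Qed.

End ScheduleFacts.

(** * The failure probability *)

Section Bound.
Context {R : realType} (mu : probability R R) (alpha beta eta r b d : R) (k : nat).
Local Notation F := (arcF r).
Local Notation B1 := (arcB1 r).
Local Notation B2 := (arcB2 r).
Local Notation x := (k%:R : R).
Local Notation L := (ln (kN k)%:R : R).
Local Notation A := ((kA k)%:R : R).
Local Notation M := ((kM k)%:R : R).
Local Notation D := (F alpha - F beta).
Local Notation lam := (D * (A / L)).
Local Notation thr := (kthr alpha k).
(** [h1] makes the screening threshold nonnegative, [h2] lets the gap between b and e^d / 2 absorb
    the Taylor remainder, [h3] keeps each exponent increment at most d, [h4] keeps the final
    Chernoff parameter at most 1/2, and [h5] makes a group without a passing arm negligible. *)
Hypotheses (rmu : reservoir mu)
  (mass : (mu [set x | (x < alpha)%R] <= (1 - eta)%:E)%E)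
  (be0 : 0 < beta) (ba : beta < alpha) (al1 : alpha < 1) (eta01 : 0 < eta < 1)
  (r01 : 0 < r < 1) (d0 : 0 < d) (db : expR d / 2 < b) (D0 : 0 < D)
  (k2 : (2 <= k)%N) (h1 : 1 <= alpha * x) (h2 : B2 <= (b - expR d / 2) * (D * x / 8))
  (h3 : 2 * D * B1 / d <= x) (h4 : 2 * D * B1 <= x) (h5 : 2 * D * B1 <= eta * x).

Let k0 : (0 < k)%N. Proof. exact: ltnW. Qed.
Let x2 : 2 <= x. Proof. by rewrite ler_nat. Qed.
Let x1 : 1 <= x. Proof. by rewrite ler1n. Qed.
Let x0 : 0 < x. Proof. by rewrite ltr0n. Qed.
Let M0 : 0 < M. Proof. by rewrite ltr0n kM_gt0. Qed.
Let A0 : 0 < A. Proof. by rewrite kA_E mulr_gt0// exprn_gt0. Qed.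
Let L4 : x ^+ 4 <= L. Proof. exact: lnN_ge. Qed.
Let x4 : x <= x ^+ 4. Proof. by rewrite -[leLHS]expr1 ler_weXn2l. Qed.
Let Lx : x <= L. Proof. exact: le_trans L4. Qed.
Let L0 : 0 < L. Proof. exact: lt_le_trans Lx. Qed.
Let L8 : L <= 8 * x ^+ 4. Proof. exact: lnN_le. Qed.
Let B10 : 0 < B1. Proof. exact: arcB1_gt0. Qed.
Let b0 : 0 < b. Proof. by apply: lt_trans db; rewrite divr_gt0// expR_gt0. Qed.
Let lam0 : 0 < lam. Proof. by rewrite mulr_gt0// divr_gt0. Qed.
Let ell_E : ((k ^ 6)%N)%:R = x ^+ 6 :> R. Proof. exact: natrX. Qed.
Let eta0 : 0 < eta. Proof. by case/andP: eta01. Qed.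

Let F_mono u v : 0 <= u -> u <= v -> v <= 1 -> F u <= F v.
Proof. by move=> u0 uv v1; have /andP[] := arcF_lip r r01 _ _ u0 uv v1. Qed.

Let lamM_ge : D * x / 8 <= lam / M.
Proof.
have -> : lam / M = D * (x ^+ 9 / L) by rewrite kA_E; field; rewrite !gt_eqF.
rewrite -mulrA ler_pM2l// ler_pdivlMr//.
apply: (@le_trans _ _ (x / 8 * (8 * x ^+ 4))).
  by rewrite ler_wpM2l// divr_ge0// ltW.
have -> : x / 8 * (8 * x ^+ 4) = x ^+ 5 by field.
by rewrite ler_weXn2l.
Qed.

Let lamM_le : lam / M <= D * x ^+ 5.
Proof.
have -> : lam / M = D * (x ^+ 9 / L) by rewrite kA_E; field; rewrite !gt_eqF.
have -> : x ^+ 9 = x ^+ 5 * x ^+ 4 by rewrite -exprD.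
by rewrite ler_pM2l// ler_pdivrMr// ler_pM2l ?exprn_gt0.
Qed.

Let X0 : R := lam * B1 / d.

Let X0_le c : 0 < c -> D * B1 / d * c <= L -> X0 <= A / c.
Proof.
move=> c0 h; rewrite ler_pdivlMr// /X0.
have -> : lam * B1 / d * c = D * B1 / d * c * (A / L) by field; rewrite !gt_eqF.
by apply: (@le_trans _ _ (L * (A / L))); [rewrite ler_pM2r ?divr_gt0|rewrite mulrC divfK ?gt_eqF].
Qed.

Let half_bound : D * B1 / d * 2 <= L.
Proof. by apply: le_trans Lx; apply: le_trans h3; rewrite le_eqVlt; apply/orP; left; apply/eqP; ring. Qed.

Let step i s t : (i < kM k)%N -> (s <= t)%N -> X0 <= i.+1%:R * t%:R ->
  pot F b (lam / i.+1%:R) s.+1 t.+1 + pot F b (lam / i.+1%:R) s t.+1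
    <= pot F b (lam / i.+1%:R) s t.
Proof.
move=> iM st Xt; have i0 : 0 < i.+1%:R :> R by rewrite ltr0n.
apply: (pot_step F (arcF1 r) B1 B2 b d) => //.
- exact: arcF_taylor.
- exact: arcF1_bound.
- exact: arcF1_speed.
- exact: ltW.
- exact/ltW/arcB2_gt0.
- by rewrite divr_ge0// ltW.
- apply: (@le_trans _ _ (d * t%:R)); last by rewrite ler_pM2l// ler_nat !leqW.
  have Xt' : lam * B1 <= d * (i.+1%:R * t%:R) by rewrite [leRHS]mulrC -ler_pdivrMr.
  by rewrite mulrAC ler_pdivrMr// -[leRHS]mulrA [X in d * X]mulrC.
- apply: le_trans h2 _; rewrite ler_wpM2l ?subr_ge0 ?(ltW db)//.
  apply: le_trans lamM_ge _; rewrite ler_pM2l//.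
  by rewrite lef_pV2 ?posrE// ler_nat.
Qed.

Let C0 : R := (ktau k 1).+1%:R *
  expR (lam * F beta + (lam * B1) ^+ 2 / (ktau k 1)%:R + 1).

Lemma rejC_le j : rejC b lam A C0 (ktau k) j <=
  C0 * (A + 2) ^+ j * expR (b * lam ^+ 2 / A * \sum_(i < j) i.+1%:R^-1).
Proof.
have C00 : 0 <= C0 by rewrite mulr_ge0 ?expR_ge0.
have A2 : 0 <= A + 2 by rewrite addr_ge0// ltW.
elim: j => [|j IH] /=; first by rewrite big_ord0 mulr0 expR0 expr0 !mulr1.
rewrite big_ord_recr /= mulrDr expRD.
have -> : b * lam ^+ 2 / (A * j.+1%:R) = b * lam ^+ 2 / A / j.+1%:R.
  by rewrite invfM [LHS]mulrA.
have tA : (ktau k j.+2).+1%:R <= A + 2.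
  by rewrite -natrD ler_nat addn2 !ltnS leq_div.
set E1 := expR (_ / j.+1%:R); set E2 := expR _ in IH *.
have -> : C0 * (A + 2) ^+ j.+1 * (E2 * E1)
    = (C0 * (A + 2) ^+ j * E2) * ((A + 2) * E1).
  by rewrite [_ ^+ j.+1]exprSr; move: (_ ^+ j) => y; ring.
have rC0 := rejC_ge0 b lam A C0 (ktau k) C00 j.
by apply: ler_pM => //; rewrite ?mulr_ge0 ?expR_ge0// ler_wpM2r ?expR_ge0.
Qed.

Let n := (k ^ 6).-1.
Let ell_pred : (k ^ 6)%N = n.+1. Proof. by rewrite prednK// expn_gt0 k0. Qed.
Let n_E : n.+1%:R = x ^+ 6 :> R. Proof. by rewrite -ell_pred. Qed.

Let al_x : 0 <= alpha - x^-1.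
Proof. by rewrite subr_ge0 -[leLHS]mul1r ler_pdivrMr. Qed.

Let thr_itv : thr%:R <= (alpha - x^-1) * x ^+ 6 < thr.+1%:R.
Proof.
rewrite /kthr -ell_E; apply: truncn_itv.
by rewrite mulr_ge0.
Qed.

Let thr_le : (thr <= n.+1)%N.
Proof.
have /andP[h _] := thr_itv.
rewrite -(ler_nat R) n_E (le_trans h)// ler_piMl ?exprn_ge0// ?(ltW x0)//.
by rewrite lerBlDr (le_trans (ltW al1))// lerDl invr_ge0 ltW.
Qed.

Let F_thr : F alpha - 3 * B1 / x <= F (est thr n.+1).
Proof.
have /andP[e0 e1] := @est01 R _ _ thr_le.
have g0 : 0 <= 3 * B1 / x by rewrite !mulr_ge0 ?invr_ge0 ?(ltW x0)// ltW.
have al0 : 0 < alpha by exact: lt_trans ba.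
case: (leP alpha (est thr n.+1)) => h.
  by have := F_mono _ _ (ltW al0) h e1; lra.
have /andP[_ h'] := arcF_lip r r01 _ _ e0 (ltW h) (ltW al1).
suff : alpha - est thr n.+1 <= 3 / x.
  have -> : 3 * B1 / x = B1 * (3 / x) by rewrite mulrAC mulrC.
  by move=> /(ler_wpM2l (ltW B10)); move: h'; move: (B1 * (3 / x)) => z; lra.
have /andP[_ ht] := thr_itv.
(* The numerator thr + 1 makes up for the truncation, 1/x is the margin of [kthr], and the other 2/x
   pays for the 2 in the denominator. *)
rewrite lerBlDr -lerBlDl /est ler_pdivlMr ?ltr0n//.
apply: le_trans (ltW ht).
have -> : n.+3%:R = x ^+ 6 + 2 :> R by rewrite -n_E -natrD addn2.
have y6 : x <= x ^+ 6 by rewrite -[leLHS]expr1 ler_weXn2l.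
have xv : x^-1 * x ^+ 6 >= 1 by rewrite mulrC ler_pdivlMr// mul1r.
have xi : 0 < x^-1 by rewrite invr_gt0.
by move: xv xi; move: (x^-1) (x ^+ 6) => i y; move: al1; nra.
Qed.

(** The margin gains v x^5 against a second-order loss alpha v^2 x^6; v = 1/(2x) leaves the exponent
    -x^4 (2 - alpha)/4. *)
Let tail p : alpha <= p <= 1 ->
  expR ((2 * x)^-1 * thr%:R) * (1 - p + p * expR (- (2 * x)^-1)) ^+ n.+1 <= 2^-1.
Proof.
move=> /andP[ap p1]; set v := (2 * x)^-1.
have v0 : 0 < v by rewrite invr_gt0 mulr_gt0.
have p0 : 0 <= p by apply: le_trans ap; apply/ltW/(lt_trans be0).
have ev : expR (- v) <= 1 - v + v ^+ 2.
  have := @expR_le_quadratic R 0 (- v) (lexx _); rewrite expR0 sqrrN mul1r.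
  have := sqr_ge0 v; have : - v <= 0 by rewrite oppr_le0 ltW.
  by move=> vn vs /(_ vn); lra.
have e1 : 1 - p + p * expR (- v) <= expR (- (alpha * (v - v ^+ 2))).
  apply: le_trans (expR_ge1Dx _).
  have vv : 0 <= v - v ^+ 2.
    by rewrite subr_ge0 expr2 ler_piMl ?(ltW v0)// /v invf_le1 ?mulr_gt0//; move: x1; lra.
  have := ler_wpM2l p0 ev; have := ler_wpM2r vv ap; lra.
apply: (@le_trans _ _ (expR (v * ((alpha - x^-1) * x ^+ 6))
    * expR (- (alpha * (v - v ^+ 2))) ^+ n.+1)).
  apply: ler_pM; rewrite ?expR_ge0// ?exprn_ge0//.
  - by rewrite addr_ge0 ?subr_ge0// mulr_ge0// expR_ge0.
  - by rewrite ler_expR ler_wpM2l ?(ltW v0)//; case/andP: thr_itv.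
  - by rewrite lerXn2r ?nnegrE ?expR_ge0// addr_ge0 ?subr_ge0// mulr_ge0// expR_ge0.
rewrite -expRM_natl n_E -expRD.
apply: (@le_trans _ _ (expR (- 1))); last first.
  by rewrite expRN lef_pV2 ?posrE ?expR_gt0// (le_trans _ (expR_ge1Dx _)).
rewrite ler_expR.
have -> : v * ((alpha - x^-1) * x ^+ 6) + x ^+ 6 * - (alpha * (v - v ^+ 2))
   = - (x ^+ 4 * (2 - alpha) / 4) by rewrite /v; field; rewrite gt_eqF.
rewrite lerN2 ler_pdivlMr// mul1r.
have : 4 <= x ^+ 4.
  by apply: le_trans (_ : 2 ^+ 4 <= _); [rewrite -natrX ler_nat|rewrite lerXn2r ?nnegrE// ltW].
by move: al1; move: (x ^+ 4) => y; nra.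
Qed.

Local Notation kap := (lam / M).
Let e0 : R := expR (- (kap * F 0) + b * kap ^+ 2 / n.+3%:R).
Let e1 : R := expR (- (kap * F (est thr n.+1)) + b * kap ^+ 2 / n.+3%:R).
Let kap0 : 0 < kap. Proof. by rewrite divr_gt0. Qed.

Let Ue (s : nat) (y : R) : y <= F (est s n.+1) ->
  pot F b kap s n.+1
    <= expR (- (kap * y) + b * kap ^+ 2 / n.+3%:R) * mix s n.+1.
Proof.
move=> h; rewrite /pot [leLHS]mulrC ler_pM2r ?mix_gt0// ler_expR lerD2r lerN2.
by rewrite ler_pM2l.
Qed.

(** That the first k^6 arms all fail has weight at most exp(-eta x^6 / 2), whereas e0 / e1 is at
    most exp(D B1 x^5). By [h5] the product is at most 1; this is why a group needs more than about
    x^5 arms. *)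
Lemma group_factor_le : group_factor eta e0 e1 (k ^ 6) <= (x ^+ 6 + 1) * e1.
Proof.
have e00 : 0 <= e0 by exact: expR_ge0.
have e10 : 0 <= e1 by exact: expR_ge0.
have q0 : 0 <= 1 - eta / 2 by have := eta01; lra.
have h j : group_factor eta e0 e1 j <= j%:R * e1 + (1 - eta / 2) ^+ j * e0.
  elim: j => [|j IH] /=; first by rewrite mul0r add0r expr0 mul1r.
  have := ler_wpM2l q0 IH; rewrite exprS -[j.+1%:R]natr1.
  have : 0 <= eta / 2 * (j%:R * e1) by rewrite !mulr_ge0// ltW.
  move: (_ ^+ j) (j%:R) => v w.
  by lra.
apply: le_trans (h _) _; rewrite ell_E mulrDl lerD2l mul1r.
apply: (@le_trans _ _ (expR (- (eta / 2) * x ^+ 6) * e0)).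
  rewrite ler_wpM2r// -ell_E expRM_natr lerXn2r ?nnegrE ?expR_ge0//.
  exact: expR_ge1Dx.
rewrite -expRD ler_expR addrA lerD2r.
have /andP[e_0 e_1] := @est01 R _ _ thr_le.
have /andP[_ hF] := arcF_lip r r01 _ _ (lexx 0) e_0 e_1.
have hF' : F (est thr n.+1) - F 0 <= B1.
  apply: (@le_trans _ _ (B1 * (est thr n.+1 - 0))); first by move: hF; lra.
  by rewrite subr0 ler_piMr// ltW.
have a1 : kap * (F (est thr n.+1) - F 0) <= D * x ^+ 5 * B1.
  apply: (@le_trans _ _ (kap * B1)); first by rewrite ler_pM2l.
  by rewrite ler_pM2r.
have a2 : D * x ^+ 5 * B1 <= eta / 2 * x ^+ 6.
  have -> : D * x ^+ 5 * B1 = x ^+ 5 / 2 * (2 * D * B1) by field.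
  have -> : eta / 2 * x ^+ 6 = x ^+ 5 / 2 * (eta * x) by rewrite exprSr; field.
  by rewrite ler_wpM2l// divr_ge0// exprn_ge0// ltW.
by move: a1 a2; move: kap (x ^+ 6) (D * _ * _) => u v w; lra.
Qed.

Lemma kprog_product_bound :
  (prog_low mu beta (kprog alpha k) (fun=> None) <=
    (rejC b lam A C0 (ktau k) (kM k).-1 * group_factor eta e0 e1 (k ^ 6) ^+ kM k)%:E)%E.
Proof.
have C00 : 0 <= C0 by rewrite mulr_ge0 ?expR_ge0.
have Mp : (kM k).-1.+1 = kM k by rewrite prednK ?kM_gt0.
have tauX i : X0 <= i.+1%:R * (ktau k i.+2)%:R.
  have h : A <= 2 * (i.+1%:R * (ktau k i.+2)%:R).
    apply: le_trans (@ktauA R k i.+1) _; rewrite mulrA ler_wpM2r//.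
    by rewrite -natrM ler_nat mul2n -addnn addSn ltnS leq_addl.
  have := X0_le 2 ltac:(by []) half_bound.
  by move: h; move: X0 (_ * (ktau _ _)%:R) => u v; lra.
have final p s : 0 <= p < beta -> p <= 1 -> (s <= ktau k 1)%N ->
    lik p s (ktau k 1) <= C0 * pot F b lam s (ktau k 1).
  move=> pb p1 st.
  apply: (lik_low_mean F b lam B1 beta p s (ktau k 1) (arcF_lip r r01)) => //;
    try exact: ltW.
    by rewrite (ltW be0)/= ltW// (lt_trans ba).
  apply: (@le_trans _ _ (A / 2)); last first.
    by rewrite ler_pM2r// (le_trans (@ktauA R k 0))// mul1r.
  have -> : lam * B1 = A / 2 * (2 * D * B1 / L) by field; rewrite gt_eqF.
  by rewrite ler_piMr ?divr_ge0// ?(ltW A0)// ler_pdivrMr// mul1r (le_trans h4).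
have F_est s s' : (s <= s')%N -> (s' <= n.+1)%N -> F (est s n.+1) <= F (est s' n.+1).
  move=> ss' s'n; have /andP[u0 _] := @est01 R s n.+1 (leq_trans ss' s'n).
  have /andP[_ u1] := @est01 R s' n.+1 s'n.
  by apply: F_mono => //; rewrite /est ler_pM2r ?invr_gt0 ?ltr0n// ler_nat ltnS.
have thr1 := thr_le.
have := @screen_le R mu beta alpha eta rmu mass eta01 thr n (k ^ 6)
  (pot F b kap) e0 e1 (2 * x)^-1.
move=> /(_ _ _ _ _ _ tail (kM k) 0 [::] (fun=> None) (rejC b lam A C0 (ktau k) (kM k).-1)
  (fun l => rejects (ktau k) (kM k).-1 l n.+1)).
rewrite big_nil mulr1 /kprog {1}ell_pred -ell_pred; apply => //.
- rewrite expR_ge0 ler_expR lerD2r lerN2 ler_pM2l//.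
  have /andP[u0 u1] := @est01 R _ _ thr1.
  exact: F_mono.
- by move=> s t; exact: pot_ge0.
- rewrite ell_pred => s sn; apply: Ue => //; have /andP[u0 u1] := @est01 R _ _ sn.
  exact: F_mono.
- by rewrite ell_pred => s /andP[ts sn]; apply: Ue => //; exact: F_est.
- exact: rejC_ge0.
- move=> m' l; rewrite addn0 ell_pred => sl vl.
  have := @rejects_le R mu beta F b lam A X0 C0 (ktau k) (kM k).
  move=> /(_ (ltW lam0) (ltW b0) A0 C00 F_mono step (ktau_dec k)).
  move=> /(_ tauX (@ktauA R k) final (kM k).-1 l n.+1 m').
  rewrite Mp leqnn; apply => //.
  + by rewrite -ell_pred ktau_start.
  (* The rejections start with M arms at k^6 samples each, and M x^6 = A / x^3. *)
  + apply: (@le_trans _ _ (A / x ^+ 3)).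
      apply: X0_le; first by rewrite exprn_gt0.
      have x43 : x ^+ 4 = x * x ^+ 3 by rewrite exprS.
      apply: le_trans L4; rewrite x43 ler_pM2r ?exprn_gt0//.
      apply: le_trans h3; rewrite -!mulrA ler_peMl ?ler1n//.
      by rewrite !mulr_ge0 ?invr_ge0// ltW.
    rewrite n_E kA_E le_eqVlt; apply/orP; left; apply/eqP; field.
    by rewrite gt_eqF.
Qed.

(** In units of A / L, the gain lam D is D^2 and the variance term is b D^2. Among the errors, 3 D
    B1 comes from the screening margin, D^2 B1^2 from the last arm, b D^2 / x from the reserve at
    the start of the rejections, and 136 = 64 + 64 + 8 from the mixture factors, the group factors
    x^6 + 1 and the summand 1 in [C0]. *)
Lemma kprog_bound :
  (prog_low mu beta (kprog alpha k) (fun=> None) <=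
    (expR (- (A / L * (D ^+ 2 * (1 - b)
       - (3 * D * B1 + D ^+ 2 * B1 ^+ 2 + 136 + b * D ^+ 2) / x))))%:E)%E.
Proof.
apply: le_trans kprog_product_bound _; rewrite lee_fin.
have A2 : 1 <= A + 2 by rewrite -natrD ler1n addn2.
have A20 : 0 < A + 2 by exact: lt_le_trans A2.
have g0 : 0 < x ^+ 6 + 1 by rewrite addr_gt0// exprn_gt0.
have e00 : 0 <= e0 by exact: expR_ge0.
have e10 : 0 <= e1 by exact: expR_ge0.
have e1e0 : 0 <= e1 <= e0.
  rewrite e10 ler_expR lerD2r lerN2 ler_pM2l//.
  by have /andP[u0 u1] := @est01 R _ _ thr_le; exact: F_mono.
have bl : 0 <= b * lam ^+ 2 by apply: mulr_ge0; [exact: ltW|exact: sqr_ge0].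
have bD : 0 <= b * D ^+ 2 by apply: mulr_ge0; [exact: ltW|exact: sqr_ge0].
have DB : 0 <= D ^+ 2 * B1 ^+ 2 by apply: mulr_ge0; exact: sqr_ge0.
set a := A / L; have a0 : 0 < a by rewrite divr_gt0.
have C0_le : C0 <= (A + 2) * expR (lam * F beta + (lam * B1) ^+ 2 / A + 1).
  apply: ler_pM => //; rewrite ?expR_ge0//.
    by rewrite -natrD ler_nat addn2 /ktau divn1.
  rewrite ler_expR lerD2r lerD2l ler_wpM2l ?sqr_ge0//.
  by rewrite lef_pV2 ?posrE// ?ltr0n// (le_trans (@ktauA R k 0))// mul1r.
have C00 : 0 <= C0 by rewrite mulr_ge0 ?expR_ge0.
have rC : rejC b lam A C0 (ktau k) (kM k).-1 <=
    (A + 2) ^+ kM k * expR (lam * F beta + (lam * B1) ^+ 2 / A + 1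
                            + b * lam ^+ 2 / A * L).
  apply: le_trans (rejC_le _) _.
  rewrite -[in X in _ <= X](prednK (kM_gt0 k)) [_ ^+ (kM k).-1.+1]exprS expRD.
  have -> : forall p q u v : R, p * q * (u * v) = p * u * q * v by move=> *; ring.
  apply: ler_pM; rewrite ?expR_ge0//.
  - by rewrite mulr_ge0// exprn_ge0// ltW.
  - by rewrite ler_wpM2r// exprn_ge0// ltW.
  - rewrite ler_expR ler_wpM2l//.
      by rewrite !mulr_ge0 ?invr_ge0 ?sqr_ge0// ltW.
    apply: (@le_trans _ _ (\sum_(i < kM k) (i.+1%:R : R)^-1)); last exact: harmonic_le_lnN.
    have := kM_gt0 k; case: (kM k) => [//|j] _; rewrite big_ord_recr /= lerDl.
    by rewrite invr_ge0.
have G : group_factor eta e0 e1 (k ^ 6) ^+ kM k <=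
    (x ^+ 6 + 1) ^+ kM k * expR (- (lam * F (est thr n.+1))
                                 + b * lam ^+ 2 / (M * x ^+ 6)).
  apply: (@le_trans _ _ (((x ^+ 6 + 1) * e1) ^+ kM k)).
    rewrite lerXn2r ?nnegrE ?group_factor_le ?mulr_ge0 ?(ltW g0)//.
    by apply: group_factor_ge0; rewrite ?e1e0.
  rewrite exprMn ler_wpM2l ?exprn_ge0 ?(ltW g0)// /e1 -expRM_natl ler_expR.
  have -> : M * (- (kap * F (est thr n.+1)) + b * kap ^+ 2 / n.+3%:R) =
     - (lam * F (est thr n.+1)) + b * lam ^+ 2 / (M * n.+3%:R).
    by field; rewrite !gt_eqF.
  rewrite lerD2l ler_wpM2l//.
  rewrite lef_pV2 ?posrE ?mulr_gt0 ?exprn_gt0// ler_pM2l// -n_E ler_nat.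
  by rewrite ltnS leqW// leqW.
apply: le_trans (ler_pM _ _ rC G) _.
- exact: (rejC_ge0 b lam A C0 (ktau k) C00 (kM k).-1).
- by rewrite exprn_ge0//; apply: group_factor_ge0; rewrite ?e1e0.
rewrite mulrACA -expRD.
have -> : (A + 2) ^+ kM k = expR (M * ln (A + 2)).
  by rewrite expRM_natl lnK// posrE.
have -> : (x ^+ 6 + 1) ^+ kM k = expR (M * ln (x ^+ 6 + 1)).
  by rewrite expRM_natl lnK// posrE.
rewrite -!expRD ler_expR.
have ML : M * L <= a * (64 / x).
  have -> : a * (64 / x) = M * (64 * x ^+ 8) / L by rewrite /a kA_E; field; rewrite !gt_eqF.
  rewrite ler_pdivlMr// -mulrA ler_pM2l//.
  have -> : 64 * x ^+ 8 = (8 * x ^+ 4) * (8 * x ^+ 4) by ring.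
  by apply: ler_pM => //; exact: ltW.
have t1 : M * ln (A + 2) <= a * (64 / x).
  by apply: le_trans ML; rewrite ler_pM2l// lnA_le.
have t2 : M * ln (x ^+ 6 + 1) <= a * (64 / x).
  by apply: le_trans ML; rewrite ler_pM2l// lng_le.
have t3 : (lam * B1) ^+ 2 / A <= a * (D ^+ 2 * B1 ^+ 2 / x).
  have -> : (lam * B1) ^+ 2 / A = a * (D ^+ 2 * B1 ^+ 2 / L).
    by rewrite /a; field; rewrite !gt_eqF.
  rewrite ler_pM2l// ler_wpM2l//.
  by rewrite lef_pV2 ?posrE.
have t4 : 1 <= a * (8 / x).
  have -> : a * (8 / x) = M * (8 * x ^+ 8) / L by rewrite /a kA_E; field; rewrite !gt_eqF.
  rewrite ler_pdivlMr// mul1r (le_trans L8)//.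
  apply: (@le_trans _ _ (8 * x ^+ 8)); first by rewrite ler_pM2l// ler_weXn2l.
  by rewrite ler_peMl ?mulr_ge0 ?exprn_ge0 ?(ltW x0)// ler1n kM_gt0.
have t5 : b * lam ^+ 2 / A * L = a * (b * D ^+ 2).
  by rewrite /a; field; rewrite !gt_eqF.
have t6 : b * lam ^+ 2 / (M * x ^+ 6) <= a * (b * D ^+ 2 / x).
  have -> : b * lam ^+ 2 / (M * x ^+ 6) = a * (b * D ^+ 2 * (x ^+ 3 / L)).
    by rewrite /a kA_E; field; rewrite !gt_eqF.
  rewrite ler_pM2l// ler_wpM2l//.
  by rewrite ler_pdivrMr// mulrC ler_pdivlMr// -exprSr.
have t7 : lam * F beta - lam * F (est thr n.+1) <= a * (- D ^+ 2 + 3 * D * B1 / x).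
  have -> : a * (- D ^+ 2 + 3 * D * B1 / x) = lam * (- D + 3 * B1 / x).
    by rewrite /a; ring.
  by rewrite -mulrBr ler_pM2l//; move: F_thr; move: (3 * B1 / x) => z; lra.
rewrite t5; move: t1 t2 t3 t4 t6 t7.
move: (M * ln (A + 2)) (M * ln (_ + 1)) (_ ^+ 2 / A) (b * lam ^+ 2 / _).
move: (lam * F beta) (lam * F (est thr n.+1)) => f1 f2 u1 u2 u3 u4.
move: (x^-1) => i; lra.
Qed.

End Bound.

(** * Passage to the limit *)

Section Limit.
Context {R : realType}.
Implicit Types (alpha beta : R).

Lemma c_const_gt0 alpha beta :
  0 < beta -> beta < alpha -> alpha < 1 -> 0 < c_const alpha beta.
Proof.
move=> b0 ba a1; rewrite /c_const divr_gt0// exprn_even_gt0//= subr_eq0.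
apply/eqP => /(congr1 cos); rewrite !acosK ?in_itv/=; first by lra.
all: by apply/andP; split; lra.
Qed.

(** At r = 1 the smoothed function is the arc length itself, and [acos] is continuous at 1 - 2y for
    0 < y < 1. *)
Lemma arcF_speed_limit alpha beta (e : R) :
  0 < beta -> beta < alpha -> alpha < 1 -> 0 < e ->
  exists2 r : R, 0 < r < 1 &
    c_const alpha beta - e < (arcF r alpha - arcF r beta) ^+ 2 / 2.
Proof.
move=> b0 ba a1 e0.
have cont y : 0 < y < 1 -> (fun r : R => arcF r y) r @[r --> (1 : R)] --> acos (1 - 2 * y).
  move=> y01; rewrite -[1 - 2 * y]mul1r.
  apply: (@continuous_comp _ _ _ (fun r : R => r * (1 - 2 * y)) (@acos R)).
    by apply: cvgMl; exact: cvg_id.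
  by apply: continuous_acos; rewrite mul1r; lra.
have cg : ((arcF r alpha - arcF r beta) ^+ 2 / 2) @[r --> (1 : R)]
    --> c_const alpha beta.
  apply: cvgMl; rewrite expr2; apply: cvgM; apply: cvgB; apply: cont; lra.
have /cvgr_gt/(_ (c_const alpha beta - e)) := cg.
rewrite ltrBlDr ltrDl e0 => /(_ isT) /nbhs_ballP [rho /= rho0 hrho].
pose s := Num.min rho 1 / 2.
have s0 : 0 < s by rewrite divr_gt0// lt_min rho0/=.
have s1 : s < 1 by rewrite ltr_pdivrMr// mul1r gt_min; apply/orP; right; lra.
have sr : s < rho.
  by rewrite ltr_pdivrMr// gt_min; apply/orP; left; lra.
exists (1 - s); first by rewrite subr_gt0 s1/= gtrBl.
by apply: hrho; rewrite /ball /= opprB addrCA subrr addr0 gtr0_norm.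
Qed.

Lemma leq_kN k : (k <= kN k)%N.
Proof. by elim: k => // k IH; apply: leq_ltn_trans IH _; exact: kN_mono. Qed.

(** [k0] is chosen before the reservoir, which may vary with N. The loss e is shared in thirds
    between r < 1, b > 1/2 and the errors of order 1/x. *)
Lemma kprog_rate (alpha beta eta e : R) :
  0 < beta -> beta < alpha -> alpha < 1 -> 0 < eta < 1 ->
  0 < e -> e < c_const alpha beta ->
  exists k0, forall k (mu : probability R R), (k0 <= k)%N -> reservoir mu ->
    (mu [set x | (x < alpha)%R] <= (1 - eta)%:E)%E ->
    (((c_const alpha beta - e)%:E <= neglog (prog_low mu beta (kprog alpha k) (fun=> None))
       * ((ln (kN k)%:R) ^+ 2 / (kN k)%:R)%:E)%E).
Proof.
move=> b0 ba a1 eta01 e0 ec; set c := c_const alpha beta in ec *.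
have [r r01] := arcF_speed_limit alpha beta (e / 3) b0 ba a1 ltac:(by rewrite divr_gt0).
rewrite -/c; set D := arcF r alpha - arcF r beta => hD.
have /andP[eta0 _] := eta01.
have D0 : 0 < D.
  rewrite lt_def; apply/andP; split.
    by apply: contraTneq hD => ->; rewrite -leNgt expr0n mul0r; lra.
  by have /andP[h _] := arcF_lip r r01 _ _ (ltW b0) (ltW ba) (ltW a1); rewrite subr_ge0.
pose s := e / (3 * D ^+ 2); have s0 : 0 < s by rewrite divr_gt0// mulr_gt0// exprn_gt0.
have Ds : D ^+ 2 * s = e / 3 by rewrite /s; field; rewrite gt_eqF.
pose b := 1 / 2 + s; pose d := ln (1 + 2 * s) / 2.
have s2 : 0 < 2 * s by rewrite mulr_gt0.
have d0 : 0 < d by rewrite divr_gt0// ln_gt0// ltrDl.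
have db : expR d / 2 < b.
  have : expR d < 1 + 2 * s.
    rewrite -[ltRHS](@lnK R) ?posrE ?addr_gt0// ltr_expR /d.
    by have : 0 < ln (1 + 2 * s); [rewrite ln_gt0// ltrDl|lra].
  by rewrite /b; lra.
pose B1 := arcB1 r; pose B2 := arcB2 r.
have B10 : 0 < B1 := arcB1_gt0 r r01; have B20 : 0 < B2 := arcB2_gt0 r r01.
pose S := 3 * D * B1 + D ^+ 2 * B1 ^+ 2 + 136 + b * D ^+ 2.
have bb : 0 < b by rewrite /b addr_gt0// divr_gt0.
have S0 : 0 < S.
  have DB0 : 0 < D * B1 by rewrite mulr_gt0.
  have DDB : 0 < D ^+ 2 * B1 ^+ 2 by apply: mulr_gt0; exact: exprn_gt0.
  have bDD : 0 < b * D ^+ 2 by apply: mulr_gt0 => //; exact: exprn_gt0.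
  by rewrite /S; lra.
(* T1 to T5 give the conditions [h1] to [h5] of [kprog_bound]; T6 settles the errors of order
   1/x. *)
pose T1 := 1 / alpha; pose T2 := 8 * B2 / ((b - expR d / 2) * D).
pose T3 := 2 * D * B1 / d; pose T4 := 2 * D * B1; pose T5 := 2 * D * B1 / eta.
pose T6 := 3 * (S + 3 * D ^+ 2) / e.
have al0 : 0 < alpha by exact: lt_trans ba.
have bd0 : 0 < b - expR d / 2 by rewrite subr_gt0.
have T10 : 0 < T1 by rewrite divr_gt0.
have T20 : 0 < T2 by apply: divr_gt0; apply: mulr_gt0.
have T40 : 0 < T4 by apply: mulr_gt0 => //; apply: mulr_gt0.
have T30 : 0 < T3 by apply: divr_gt0.
have T50 : 0 < T5 by apply: divr_gt0.
have D20 : 0 < D ^+ 2 by exact: exprn_gt0.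
have T60 : 0 < T6.
  by apply: divr_gt0 => //; apply: mulr_gt0 => //; apply: addr_gt0 => //; apply: mulr_gt0.
pose T := 2 + T1 + T2 + T3 + T4 + T5 + T6.
have T0 : 0 <= T by rewrite /T; lra.
exists (Num.bound T) => k mu Tk rmu mass.
have xT : T <= k%:R by apply: (le_trans (ltW (archi_boundP T0))); rewrite ler_nat.
set x : R := k%:R in xT.
have [x2 [x_1 [x_2 [x_3 [x_4 [x_5 x_6]]]]]] : 2 <= x /\ T1 <= x /\ T2 <= x /\
    T3 <= x /\ T4 <= x /\ T5 <= x /\ T6 <= x.
  by move: xT; rewrite /T; move: (T1) (T2) (T3) (T4) (T5) (T6) T10 T20 T30 T40 T50 T60
    => ? ? ? ? ? ? ? ? ? ? ? ?; do !split; lra.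
have k2 : (2 <= k)%N by rewrite -(ler_nat R).
have x0 : 0 < x by lra.
have h1 : 1 <= alpha * x by move: x_1; rewrite ler_pdivrMr// mulrC.
have h2 : B2 <= (b - expR d / 2) * (D * x / 8).
  by move: x_2; rewrite ler_pdivrMr ?mulr_gt0//; move: (b - _) => z; lra.
have h5 : 2 * D * B1 <= eta * x by move: x_5; rewrite ler_pdivrMr// [eta * x]mulrC.
have := @kprog_bound R mu alpha beta eta r b d k rmu mass b0 ba a1 eta01 r01 d0 db D0 k2
  h1 h2 x_3 x_4 h5.
have P0 : (0 <= prog_low mu beta (kprog alpha k) (fun=> None))%E.
  by apply: prog_low_ge0.
have L4 : x ^+ 4 <= ln (kN k)%:R by exact: lnN_ge.
have NA : (kN k)%:R <= (kA k)%:R * ln (kN k)%:R * (1 + 3 / x) :> R by exact: kN_le.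
have N0 : 0 < (kN k)%:R :> R by rewrite ltr0n kN_gt0.
have A0 : 0 < (kA k)%:R :> R by rewrite ltr0n muln_gt0 kM_gt0 expn_gt0 (ltnW k2).
move: P0; case: (prog_low _ _ _ _) => [p| |] //.
rewrite lee_fin => p0; rewrite lee_fin -/D -/B1 -/S -/x.
set L := ln _ in L4 NA *; set N := (kN k)%:R in NA N0 *; set A := (kA k)%:R in NA A0 *.
have L0 : 0 < L by apply: lt_le_trans L4; rewrite exprn_gt0.
have LN0 : 0 < L ^+ 2 / N by rewrite divr_gt0// exprn_gt0.
set Z := D ^+ 2 * (1 - b) - S / x => pZ.
have i0 : 0 < x^-1 by rewrite invr_gt0.
have Zlow : c - e + 3 * D ^+ 2 / x <= Z.
  have : (S + 3 * D ^+ 2) / x <= e / 3.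
    rewrite ler_pdivrMr//; move: x_6; rewrite /T6 ler_pdivrMr//.
    by move: (S) (D ^+ 2) => u v; lra.
  move: hD Ds; rewrite /Z /b mulrDl; move: (D ^+ 2) (S / x) => u v; lra.
have Z0 : 0 < Z.
  apply: lt_le_trans Zlow; rewrite addr_gt0 ?subr_gt0//.
  by rewrite divr_gt0// mulr_gt0// exprn_gt0.
have ZD : Z <= D ^+ 2.
  have : 0 < S / x by rewrite divr_gt0.
  have : 0 < D ^+ 2 * b by rewrite mulr_gt0// exprn_gt0.
  by rewrite /Z; move: (S / x) => v; lra.
have NLA : 1 - 3 / x <= A / L * (L ^+ 2 / N).
  have -> : A / L * (L ^+ 2 / N) = A * L / N by field; rewrite !gt_eqF.
  rewrite ler_pdivlMr//; have [neg|pos] := leP (1 - 3 / x) 0.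
    apply: (@le_trans _ _ 0); first by rewrite mulr_le0_ge0// ltW.
    by rewrite mulr_ge0// ltW.
  apply: le_trans (ler_wpM2l (ltW pos) NA) _.
  have AL : 0 <= A * L by rewrite mulr_ge0// ltW.
  have : 0 <= A * L * (x^-1) ^+ 2 by rewrite mulr_ge0// sqr_ge0.
  by move: (A * L) (x^-1) => u v; lra.
have main : c - e <= A / L * Z * (L ^+ 2 / N).
  have -> : A / L * Z * (L ^+ 2 / N) = Z * (A / L * (L ^+ 2 / N)) by rewrite mulrAC mulrC.
  apply: le_trans (ler_wpM2l (ltW Z0) NLA).
  have := ler_wpM2r (ltW i0) ZD; move: Zlow; move: (D ^+ 2) (x^-1) => u v; lra.
rewrite /neglog; have [->|pn0] := eqVneq p 0.
  by rewrite eqxx gt0_mulye ?lte_fin// leey.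
have pp : 0 < p by rewrite lt_def pn0.
rewrite (_ : (p%:E == 0%E) = false); last by rewrite eqe (negbTE pn0).
rewrite /= -EFinM lee_fin (le_trans main)// ler_pM2r//.
rewrite lerNr; apply: le_trans (_ : _ <= ln (expR (- (A / L * Z)))) _.
  by rewrite ler_ln// posrE// expR_gt0.
by rewrite expRK.
Qed.

End Limit.

Theorem theorem1p6 (R : realType) (alpha beta : R) :
  0 < beta -> beta < alpha -> alpha < 1 ->
  exists A : nat -> algo R,
    forall (eta : R) (mu : nat -> probability R R),
      0 < eta < 1 ->
      (forall N, reservoir (mu N)) ->
      (forall N, alpha <= Ginv (mu N) (1 - eta)) ->
      ((c_const alpha beta)%:E <=
       limn_esup (fun N : nat =>
         neglog (prob_low (A N) (mu N) beta N) *
         ((ln N%:R) ^+ 2 / N%:R)%:E))%E.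
Proof.
move=> b0 ba a1.
(* For N outside the range of [kN] the default k = 0 gives some algorithm cut off after N samples;
   the bound on the upper limit uses only the other lengths. *)
exists (fun N => algo_of (kprog alpha (xget 0%N [set k | kN k = N]))).
move=> eta mu eta01 rmu hG.
rewrite /limn_esup limf_esupE; apply: le_ereal_inf_tmp => _ [V [n0 _ Vn] <-].
apply/lee_addgt0Pr => e e0.
have c0 := c_const_gt0 alpha beta b0 ba a1.
(* The target c - e' has to be positive in [kprog_rate], hence the cap c / 2. *)
pose e' := Num.min e (c_const alpha beta / 2).
have e'0 : 0 < e' by rewrite lt_min e0/= divr_gt0.
have e'c : e' < c_const alpha beta by rewrite gt_min; apply/orP; right; lra.
have [k0 hk0] := kprog_rate alpha beta eta e' b0 ba a1 eta01 e'0 e'c.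
pose k := maxn 1 (maxn k0 n0); pose N := kN k.
have kk0 : (k0 <= k)%N by rewrite /k !leq_max leqnn orbT.
have kn0 : (n0 <= k)%N by rewrite /k !leq_max leqnn !orbT.
have k1 : (0 < k)%N by rewrite /k leq_max.
have xk : xget 0%N [set j | kN j = N] = k.
  by apply: kN_inj; apply: (@xgetPex _ 0%N [set j | kN j = N]); exists k.
have := hk0 k (mu N) kk0 (rmu N) (Ginv_le_mass (mu N) alpha eta (rmu N) eta01 (hG N)).
have <- : prob_low (algo_of (kprog alpha k)) (mu N) beta N
    = prog_low (mu N) beta (kprog alpha k) (fun=> None).
  by rewrite /prob_low run_prog//; exact: kprog_depth.
move=> h.
apply: (@le_trans _ _ ((c_const alpha beta - e')%:E + e%:E)%E).
  rewrite -EFinD lee_fin -addrA lerDl addrC subr_ge0 ge_min lexx//.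
rewrite leeD2r// (le_trans h)//; apply: ereal_sup_ubound.
by exists N; [apply: Vn; apply: leq_trans kn0 (leq_kN k)|rewrite xk].
Qed.
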